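(* Let $\Delta\in\{1,2,\dots\}$ and let $s\in\mathbb{C}$ with $s\neq 1$. Then $$\zeta(s)=1+\frac{1}{s-1}\sum_{k=0}^{\Delta-1}\binom{s+k-2}{k}B_k-\frac{1}{s-1}\sum_{i=\Delta}^{\infty}\bigl(\zeta(s+i)-1\bigr)\binom{s+i-1}{i+1}\sum_{k=0}^{\Delta-1}\binom{i+1}{k}B_k .$$ Here, at those $s\ne 1$ for which some term of the right-hand side is undefined because $\zeta$ is evaluated at its pole (i.e. $s+i=1$ for some $i\ge\Delta$), the right-hand side is understood as its limit as $s'\to s$ through points $s'$ at which all terms are defined.
   Context: $\zeta$ denotes the Riemann zeta function, meromorphically continued to $\mathbb{C}$ with its only pole (simple, residue $1$) at $1$. $B_k$ are the Bernoulli numbers with $B_0=1$, $B_1=-\tfrac12$, $B_2=\tfrac16$, and $\sum_{k=0}^{m}\binom{m+1}{k}B_k=0$ for $m\ge 1$. For $z\in\mathbb{C}$ and an integer $n\ge 0$, $\binom{z}{n}=\frac{z(z-1)\cdots(z-n+1)}{n!}$ is the generalized binomial coefficient (equal to $1$ for $n=0$). *)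

(* Defs.v *)
From Stdlib Require Import Lra Lia Reals Factorial.
From Coquelicot Require Import Coquelicot.

Open Scope R_scope.

(* [bernoulli_upto n k] is B_k for k <= n; it solves the recurrence
   sum_(k <= m) binom(m+1, k) B_k = 0 for its last term, whose coefficient
   is m+1. *)
Fixpoint bernoulli_upto (n : nat) : nat -> R :=
  match n with
  | O => fun _ => 1
  | S m => fun k =>
      if (k <=? m)%nat then bernoulli_upto m k
      else - sum_f_R0 (fun j => Binomial.C (S n) j * bernoulli_upto m j) m
           / INR (S n)
  end.

Definition bernoulli (n : nat) : R := bernoulli_upto n n.

Lemma bernoulli_upto_eq (n k : nat) :
  (k <= n)%nat -> bernoulli_upto n k = bernoulli k.
Proof.
induction n as [|n IH]; intros Hk.
- now replace k with 0%nat by lia.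
- destruct (Nat.eq_dec k (S n)) as [->|Hne]; [reflexivity|].
  simpl. replace (k <=? n)%nat with true
    by (symmetry; apply Nat.leb_le; lia).
  apply IH; lia.
Qed.

Lemma bernoulli_0 : bernoulli 0 = 1.
Proof. reflexivity. Qed.

Lemma bernoulli_rec (m : nat) : (1 <= m)%nat ->
  sum_f_R0 (fun k => Binomial.C (S m) k * bernoulli k) m = 0.
Proof.
destruct m as [|m]; intros Hm; [lia|].
rewrite tech5.
replace (Binomial.C (S (S m)) (S m)) with (INR (S (S m))).
2:{ unfold Binomial.C. replace (S (S m) - S m)%nat with 1%nat by lia.
    rewrite (fact_simpl (S m)), mult_INR.
    pose proof (INR_fact_neq_0 (S m)). replace (fact 1) with 1%nat by reflexivity. rewrite INR_1. field. assumption. }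
assert (E : bernoulli (S m) =
  - sum_f_R0 (fun k => Binomial.C (S (S m)) k * bernoulli k) m / INR (S (S m))).
{ unfold bernoulli at 1. cbn [bernoulli_upto].
  replace (S m <=? m)%nat with false
    by (symmetry; apply Nat.leb_gt; lia).
  do 2 f_equal. apply sum_eq. intros i Hi.
  now rewrite bernoulli_upto_eq by assumption. }
rewrite E. field. apply not_0_INR. discriminate.
Qed.

Lemma bernoulli_1 : bernoulli 1 = - / 2.
Proof. pose proof (bernoulli_rec 1 (le_n 1)) as H.
cbn [sum_f_R0] in H. rewrite bernoulli_0 in H.
unfold Binomial.C in H; simpl in H. lra.
Qed.

Open Scope C_scope.

Fixpoint falling (z : C) (n : nat) : C :=
  match n with
  | O => 1
  | S m => falling z m * (z - INR m)
  end.

Definition Cbinom (z : C) (n : nat) : C := falling z n / INR (fact n).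

Definition Cexp (z : C) : C := exp (Re z) * (cos (Im z) + Ci * sin (Im z)).

(* The principal complex power x ^ z of a real x > 0. *)
Definition Rcpow (x : R) (z : C) : C := Cexp (z * ln x).

Definition analytic_at (f : C -> C) (z0 : C) : Prop :=
  exists a : nat -> C,
    locally z0 (fun z : C => is_pseries a (z - z0) (f z)).

(* A simple pole of residue r when r <> 0. The value of f at p is irrelevant. *)
Definition simple_pole (f : C -> C) (p r : C) : Prop :=
  exists h : C -> C,
    analytic_at h p /\ h p = r /\
    locally' p (fun z : C => f z = h z / (z - p)).

(* [zeta] is the meromorphic continuation to the plane of the Dirichlet series
   sum_(n >= 1) n ^ (- s). This determines [zeta] uniquely except for its
   meaningless value at 1. *)
Definition is_riemann_zeta (zeta : C -> C) : Prop :=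
  (forall s : C, (1 < Re s)%R ->
     is_series (fun n : nat => Rcpow (INR (S n)) (- s)) (zeta s)) /\
  (forall s : C, s <> 1 -> analytic_at zeta s) /\
  simple_pole zeta 1 1.

(* Divisions by s - 1 and values of zeta at 1 are excluded. *)
Definition terms_defined (Delta : nat) (s : C) : Prop :=
  s <> 1 /\ forall i : nat, (Delta <= i)%nat -> s + INR i <> 1.

Definition series_term (zeta : C -> C) (Delta : nat) (s : C) (i : nat) : C :=
  (zeta (s + INR i) - 1) * Cbinom (s + INR i - 1) (i + 1) *
  sum_n (fun k : nat => RtoC (Binomial.C (i + 1) k * bernoulli k)) (Delta - 1).

(* For [Delta >= 1] and [terms_defined Delta s]: the right-hand side at [s]
   converges, with value [v]. The index i = Delta + j runs over i >= Delta. *)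
Definition rhs_value (zeta : C -> C) (Delta : nat) (s v : C) : Prop :=
  exists S : C,
    is_series (fun j : nat => series_term zeta Delta s (Delta + j)) S /\
    v = 1
        + 1 / (s - 1) *
          sum_n (fun k : nat => Cbinom (s + INR k - 2) k * bernoulli k)
            (Delta - 1)
        - 1 / (s - 1) * S.

(* The same right-hand side at any [s <> 1], read as a limit through points
   where all terms are defined when some term at [s] itself is not. *)
Definition extended_rhs_value
    (zeta : C -> C) (Delta : nat) (s v : C) : Prop :=
  (terms_defined Delta s -> rhs_value zeta Delta s v) /\
  (~ terms_defined Delta s ->
   exists F : C -> C,
     (forall s' : C, terms_defined Delta s' ->
        rhs_value zeta Delta s' (F s')) /\
     filterlim F (within (terms_defined Delta) (locally s)) (locally v)).

(* Main.v *)
Require Import Defs.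
From Stdlib Require Import Reals Lra Lia Factorial Wf_nat.
From Stdlib Require Import Classical IndefiniteDescription.
From Coquelicot Require Import Coquelicot.

(** Multiply the identity by [s - 1] and let [defect s] be the difference of
    its two sides. The proof shows that the defect vanishes for real [s > 1] and
    that it is analytic at every point where all terms are defined, and then
    continues it by zero.

    _Real [s > 1]._ Put [a = s - 1], so that the [i]-th binomial factor is the
    coefficient of [x ^ (i + 1)] in [(1 - x) ^ (- a)]. Write
    [zeta (s + i) - 1] as the sum of [n ^ (- s - i)] over [n >= 2] and sum over
    [i] first ([bernoulli_column]). For each [k], the factor [binom (i + 1) k]
    turns the binomial series at [x = 1 / n] into the one with exponent
    [- (a + k)], and since [n (1 - 1 / n) = n - 1] its sum is a constant times
    [(n - 1) ^ (- (a + k))] ([binomial_column]). The terms missing at the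
    beginning of the series are evaluated by the recurrence of the Bernoulli
    numbers ([bernoulli_sum_small]); they supply [- n ^ (- (a + k))] and
    [- a n ^ (- s)]. The former makes the sum over [n] telescope, the latter
    contributes [- (s - 1) (zeta s - 1)] ([defect_real]).

    _Analyticity._ The infinite sum of the statement needs a theorem on series of
    analytic functions. Rather than uniform convergence and Cauchy's integral
    formula, the proof uses functions [f] that are the sum of a power series on
    a closed disc of radius [r], with [sum |a_k| r ^ k <= M]
    ([wiener f z0 r M]). These norms are submultiplicative for affine factors
    and countably subadditive ([wiener_series], by interchanging two absolutely
    convergent summations). The norm of [n ^ (- z)] is explicit, so that the
    terms [zeta (z + i) - 1] decay like [2 ^ (- i)] ([zeta_tail_wiener]), which
    beats the growth of the binomial factors ([terms_wiener]).

    _Continuation._ Zeros of a function that is analytic at [z0] cannot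
    accumulate at [z0] unless the function vanishes near [z0]
    ([isolated_zeros]). Hence vanishing propagates along segments
    ([continuation_segment]): from [2] to every non-real point along a vertical
    and a horizontal segment, and from there to the real points where the terms
    are defined ([defect_zero]).

    At a point [s <> 1] where some term is undefined, the right-hand side equals
    [zeta] at the neighbouring points where it is defined, so the limit is
    [zeta s] by continuity. *)

Open Scope R_scope.

(** * Rising factorials and the binomial series *)

Fixpoint rising (a : R) (n : nat) : R :=
  match n with
  | O => 1
  | S m => rising a m * (a + INR m)
  end.

Lemma rising_pos (a : R) n : 0 < a -> 0 < rising a n.
Proof.
  intros Ha. induction n as [|n IH]; simpl; [lra|].
  assert (H := pos_INR n). apply Rmult_lt_0_compat; lra.
Qed.

Lemma rising_add (a : R) k m :
  rising a (k + m) = rising a k * rising (a + INR k) m.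
Proof.
  induction m as [|m IH]; simpl.
  - rewrite Nat.add_0_r. ring.
  - rewrite Nat.add_succ_r. simpl. rewrite IH, plus_INR. ring.
Qed.

Definition rising_coef (a : R) (n : nat) : R := rising a n / INR (fact n).

Lemma rising_coef_pos (a : R) n : 0 < a -> 0 < rising_coef a n.
Proof.
  intros Ha. apply Rdiv_lt_0_compat; [now apply rising_pos|].
  apply INR_fact_lt_0.
Qed.

Lemma rising_coef_S (a : R) n :
  INR (S n) * rising_coef a (S n) = (a + INR n) * rising_coef a n.
Proof.
  unfold rising_coef. rewrite fact_simpl, mult_INR. simpl rising.
  field. split; [apply INR_fact_neq_0|apply not_0_INR; discriminate].
Qed.

Lemma rising_coef_radius (a : R) :
  0 < a -> CV_radius (rising_coef a) = Finite 1.
Proof.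
  intros Ha.
  replace (Finite 1) with (Finite (/ 1)) by (f_equal; field).
  apply CV_radius_finite_DAlembert; [|lra|].
  - intros n. apply Rgt_not_eq, rising_coef_pos, Ha.
  - apply is_lim_seq_ext with (fun n => 1 + (a - 1) * / INR (S n)).
    + intros n.
      assert (H1 := rising_coef_pos a n Ha).
      assert (H2 := rising_coef_pos a (S n) Ha).
      assert (H3 := rising_coef_S a n).
      assert (HS : 0 < INR (S n)) by (apply lt_0_INR; lia).
      rewrite Rabs_pos_eq by (apply Rlt_le, Rdiv_lt_0_compat; assumption).
      apply (Rmult_eq_reg_r (rising_coef a n * INR (S n))); [|nra].
      replace (rising_coef a (S n) / rising_coef a n *
                 (rising_coef a n * INR (S n)))
        with (INR (S n) * rising_coef a (S n)) by (field; lra).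
      rewrite H3, S_INR. field. rewrite <- S_INR. lra.
    + replace (Finite 1) with (Finite (1 + (a - 1) * 0)) by (f_equal; ring).
      apply is_lim_seq_plus'; [apply is_lim_seq_const|].
      apply is_lim_seq_mult'; [apply is_lim_seq_const|].
      apply (is_lim_seq_incr_1 (fun n => / INR n)).
      apply (is_lim_seq_inv (fun n => INR n) p_infty);
        [apply is_lim_seq_INR|discriminate].
Qed.

(** The sum [F] satisfies [F' = a F + t F'], so [F(t) (1 - t) ^ a] is
    constant. *)
Lemma binomial_series (a y : R) :
  0 < a -> 0 < y < 1 ->
  is_series (fun n => rising_coef a n * y ^ n) (Rpower (1 - y) (- a)).
Proof.
  intros Ha Hy.
  set (c := rising_coef a).
  assert (Hin : forall t, 0 <= t <= y -> Rbar_lt (Rabs t) (CV_radius c)).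
  { intros t Ht. unfold c. rewrite rising_coef_radius by exact Ha. simpl.
    rewrite Rabs_pos_eq; lra. }
  assert (HF : forall t, 0 <= t <= y ->
     is_series (fun n => c n * t ^ n) (PSeries c t)).
  { intros t Ht. apply Series_correct, (proj1 (ex_pseries_R c t)).
    apply CV_radius_inside. now apply Hin. }
  assert (HF' : forall t, 0 <= t <= y ->
     is_derive (PSeries c) t (a * PSeries c t / (1 - t))).
  { intros t Ht.
    assert (HD := is_derive_PSeries c t (Hin t Ht)).
    set (F' := PSeries (PS_derive c) t) in *.
    assert (H1 : is_series (fun n => INR (S n) * c (S n) * t ^ n) F').
    { apply (Series_correct (fun n => PS_derive c n * t ^ n)).
      apply (proj1 (ex_pseries_R (PS_derive c) t)), CV_radius_inside.
      rewrite CV_radius_derive. now apply Hin. }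
    assert (H2 : is_series (fun n => INR n * c n * t ^ n) (t * F')).
    { apply (is_series_decr_1 (fun n => INR n * c n * t ^ n)).
      match goal with |- is_series _ ?l => replace l with (t * F') end.
      2:{ change (t * F' = t * F' + - (0 * c 0%nat * 1)). ring. }
      apply is_series_ext with (2 := is_series_scal_l t _ _ H1).
      intros n. unfold scal, mult; simpl; unfold mult; simpl. ring. }
    assert (H3 := is_series_plus _ _ _ _ H2
                    (is_series_scal_l a _ _ (HF t Ht))).
    assert (E : F' = t * F' + a * PSeries c t).
    { rewrite <- (is_series_unique _ _ H1).
      apply is_series_unique.
      apply is_series_ext with (2 := H3).
      intros n.
      change (INR n * c n * t ^ n + a * (c n * t ^ n)
              = INR (S n) * c (S n) * t ^ n).
      unfold c. rewrite rising_coef_S. ring. }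
    replace (a * PSeries c t / (1 - t)) with F'; [exact HD|].
    apply (Rmult_eq_reg_r (1 - t)); [|lra].
    replace (a * PSeries c t / (1 - t) * (1 - t)) with (a * PSeries c t)
      by (field; lra).
    lra. }
  assert (EG : PSeries c 0 * Rpower (1 - 0) a = PSeries c y * Rpower (1 - y) a).
  { apply (eq_is_derive (fun t => PSeries c t * Rpower (1 - t) a)); [|lra].
    intros t Ht. unfold Rpower.
    assert (HD : Derive (fun u => PSeries c u) t = a * PSeries c t / (1 - t))
      by (exact (is_derive_unique _ _ _ (HF' t Ht))).
    auto_derive.
    - split; [eexists; now apply HF'|]. split; [lra|exact I].
    - rewrite HD. change (@zero _) with 0. unfold Rminus. field. lra. }
  rewrite PSeries_0, Rminus_0_r in EG.
  replace (Rpower 1 a) with 1 in EG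
    by (unfold Rpower; now rewrite ln_1, Rmult_0_r, exp_0).
  replace (Rpower (1 - y) (- a)) with (PSeries c y); [apply HF; lra|].
  rewrite Rpower_Ropp.
  assert (Hp : 0 < Rpower (1 - y) a) by apply exp_pos.
  apply (Rmult_eq_reg_r (Rpower (1 - y) a)); [|lra].
  rewrite <- EG. unfold c, rising_coef. simpl. field. lra.
Qed.

(** [Binomial.C j k] is [j! / k!] when [j < k], because of truncated
    subtraction; sums over all [j] need the value [0] there. *)
Definition binom (j k : nat) : R :=
  if (k <=? j)%nat then Binomial.C j k else 0.

Lemma binom_le j k : (k <= j)%nat -> binom j k = Binomial.C j k.
Proof. intros H. unfold binom. now rewrite (proj2 (Nat.leb_le k j) H). Qed.

Lemma binom_gt j k : (j < k)%nat -> binom j k = 0.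
Proof. intros H. unfold binom. now rewrite (proj2 (Nat.leb_gt k j) H). Qed.

Lemma is_series_leading_zeros (u : nat -> R) (k : nat) (l : R) :
  (forall j, (j < k)%nat -> u j = 0) ->
  is_series (fun m => u (k + m)%nat) l -> is_series u l.
Proof.
  revert u. induction k as [|k IH]; intros u Hu Hl; [exact Hl|].
  apply is_series_decr_1.
  match goal with |- is_series _ ?x => replace x with l end.
  - apply IH; [|exact Hl]. intros j Hj. apply Hu. lia.
  - rewrite (Hu 0%nat) by lia. change (l = l + - 0). ring.
Qed.

(** Since [rising_coef a j * binom j k] is
    [rising_coef a k * rising_coef (a + k) (j - k)], this is the binomial series
    of [(1 - 1 / N) ^ (- (a + k))], scaled by [N ^ (- (a + k))]. *)
Lemma binomial_column (a N : R) (k : nat) :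
  0 < a -> 1 < N ->
  is_series (fun j => rising_coef a j * binom j k * Rpower N (- (a + INR j)))
    (rising_coef a k * Rpower (N - 1) (- (a + INR k))).
Proof.
  intros Ha HN.
  apply is_series_leading_zeros with k.
  { intros j Hj. rewrite binom_gt by exact Hj. ring. }
  assert (Hak : 0 < a + INR k) by (assert (H := pos_INR k); lra).
  assert (HN' : 0 < / N < 1).
  { split; [apply Rinv_0_lt_compat; lra|].
    rewrite <- Rinv_1. apply Rinv_lt_contravar; lra. }
  assert (H := binomial_series (a + INR k) (/ N) Hak HN').
  assert (E : Rpower (N - 1) (- (a + INR k)) =
    Rpower N (- (a + INR k)) * Rpower (1 - / N) (- (a + INR k))).
  { rewrite Rpower_mult_distr by lra. f_equal. field. lra. }
  rewrite E, <- Rmult_assoc.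
  apply is_series_ext with (2 := is_series_scal_l _ _ _ H).
  intros m. rewrite binom_le by lia.
  change (rising_coef a k * Rpower N (- (a + INR k)) *
            (rising_coef (a + INR k) m * (/ N) ^ m)
          = rising_coef a (k + m) * Binomial.C (k + m) k *
            Rpower N (- (a + INR (k + m)))).
  replace (- (a + INR (k + m))) with (- (a + INR k) + - INR m)
    by (rewrite plus_INR; ring).
  rewrite Rpower_plus, (Rpower_Ropp N (INR m)), Rpower_pow by lra.
  rewrite pow_inv.
  unfold rising_coef, Binomial.C.
  replace (k + m - k)%nat with m by lia. rewrite rising_add. field.
  repeat split; try apply INR_fact_neq_0. apply pow_nonzero. lra.
Qed.

(** * Truncated Bernoulli sums *)

Definition bernoulli_sum (d j : nat) : R :=
  sum_f_R0 (fun k => binom j k * bernoulli k) d.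

Lemma binomial_n_n n : Binomial.C n n = 1.
Proof.
  unfold Binomial.C. rewrite Nat.sub_diag. simpl. field. apply INR_fact_neq_0.
Qed.

Lemma bernoulli_sum_diag (j : nat) :
  bernoulli_sum j (S j) = if (j =? 0)%nat then 1 else 0.
Proof.
  replace (bernoulli_sum j (S j)) with
    (sum_f_R0 (fun k => Binomial.C (S j) k * bernoulli k) j).
  - destruct j as [|j].
    + simpl. rewrite bernoulli_0. unfold Binomial.C. simpl. field.
    + apply bernoulli_rec. lia.
  - apply sum_eq. intros k Hk. now rewrite binom_le by lia.
Qed.

(** The recurrence of the Bernoulli numbers leaves only the last summand, with
    one exception at [j = 1]. *)
Lemma bernoulli_sum_small (d j : nat) : (j <= S d)%nat ->
  bernoulli_sum d j = (if (j <=? d)%nat then bernoulli j else 0) +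
                      (if (j =? 1)%nat then 1 else 0).
Proof.
  intros Hj.
  assert (Hext : forall m, bernoulli_sum (j + m) j = bernoulli_sum j j).
  { induction m as [|m IH]; [now rewrite Nat.add_0_r|].
    rewrite Nat.add_succ_r. unfold bernoulli_sum in *. simpl.
    rewrite IH, binom_gt by lia. ring. }
  destruct (Nat.leb_spec j d) as [H|H].
  - replace d with (j + (d - j))%nat by lia. rewrite Hext.
    destruct j as [|j].
    + unfold bernoulli_sum. simpl. rewrite binom_le, binomial_n_n by lia.
      simpl. ring.
    + change (bernoulli_sum (S j) (S j)) with
        (bernoulli_sum j (S j) + binom (S j) (S j) * bernoulli (S j)).
      rewrite bernoulli_sum_diag, binom_le, binomial_n_n by lia.
      change (S j =? 1)%nat with (j =? 0)%nat. ring.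
  - replace j with (S d) by lia. rewrite bernoulli_sum_diag.
    change (S d =? 1)%nat with (d =? 0)%nat. ring.
Qed.

Lemma is_series_sum_f_R0 (u : nat -> nat -> R) (l : nat -> R) (d : nat) :
  (forall k, is_series (u k) (l k)) ->
  is_series (fun j => sum_f_R0 (fun k => u k j) d) (sum_f_R0 l d).
Proof.
  intros H. induction d as [|d IH]; simpl; [apply H|].
  exact (is_series_plus _ _ _ _ IH (H (S d))).
Qed.

(** Summing [binomial_column] against the Bernoulli numbers and removing the
    terms of index at most [S d], which [bernoulli_sum_small] evaluates. *)
Lemma bernoulli_column (a N : R) (d : nat) :
  0 < a -> 1 < N ->
  is_series (fun j => rising_coef a (S (S d) + j) *
                      bernoulli_sum d (S (S d) + j) *
                      Rpower N (- (a + INR (S (S d) + j))))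
    (sum_f_R0 (fun k => bernoulli k * rising_coef a k *
       (Rpower (N - 1) (- (a + INR k)) - Rpower N (- (a + INR k)))) d
     - a * Rpower N (- (a + 1))).
Proof.
  intros Ha HN.
  set (u := fun j => rising_coef a j * bernoulli_sum d j *
                     Rpower N (- (a + INR j))).
  assert (Hfull : is_series u (sum_f_R0 (fun k =>
     bernoulli k * (rising_coef a k * Rpower (N - 1) (- (a + INR k)))) d)).
  { apply is_series_ext with
      (2 := is_series_sum_f_R0 _ _ d (fun k =>
        is_series_scal_l (bernoulli k) _ _ (binomial_column a N k Ha HN))).
    intros j. unfold u, bernoulli_sum.
    replace (rising_coef a j * sum_f_R0 (fun k => binom j k * bernoulli k) d *
              Rpower N (- (a + INR j)))
      with (rising_coef a j * Rpower N (- (a + INR j)) *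
              sum_f_R0 (fun k => binom j k * bernoulli k) d) by ring.
    rewrite scal_sum. apply sum_eq. intros k _.
    unfold scal; simpl; unfold mult; simpl. ring. }
  assert (Hhead : sum_f_R0 u (S d) =
     sum_f_R0 (fun k => bernoulli k *
        (rising_coef a k * Rpower N (- (a + INR k)))) d
     + a * Rpower N (- (a + 1))).
  { set (h := fun j => if (j =? 1)%nat then a * Rpower N (- (a + 1)) else 0).
    assert (Eh : forall m, sum_f_R0 h (S m) = a * Rpower N (- (a + 1))).
    { induction m as [|m IH].
      - unfold h. simpl. ring.
      - change (sum_f_R0 h (S (S m))) with (sum_f_R0 h (S m) + 0).
        rewrite IH. ring. }
    rewrite <- (Eh d).
    set (g := fun k => bernoulli k *
                (rising_coef a k * Rpower N (- (a + INR k)))).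
    replace (sum_f_R0 g d) with
      (sum_f_R0 (fun j => if (j <=? d)%nat then g j else 0) (S d)).
    - rewrite <- sum_plus. apply sum_eq. intros j Hj. unfold u, g, h.
      rewrite bernoulli_sum_small by exact Hj.
      destruct (Nat.eqb_spec j 1) as [->|Hj1].
      + replace (rising_coef a 1) with a
          by (unfold rising_coef; simpl; field).
        simpl INR. destruct (1 <=? d)%nat; ring.
      + destruct (j <=? d)%nat; ring.
    - rewrite tech5, (proj2 (Nat.leb_gt (S d) d)) by lia. rewrite Rplus_0_r.
      apply sum_eq. intros j Hj. now rewrite (proj2 (Nat.leb_le j d) Hj). }
  apply (is_series_incr_n u (S (S d))); [lia|]. simpl Nat.pred.
  rewrite sum_n_Reals, Hhead.
  match goal with |- is_series _ ?l =>
    replace l with (sum_f_R0 (fun k =>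
      bernoulli k * (rising_coef a k * Rpower (N - 1) (- (a + INR k)))) d)
  end; [exact Hfull|].
  set (G := a * Rpower N (- (a + 1))).
  change (sum_f_R0 (fun k => bernoulli k *
            (rising_coef a k * Rpower (N - 1) (- (a + INR k)))) d =
    sum_f_R0 (fun k => bernoulli k * rising_coef a k *
       (Rpower (N - 1) (- (a + INR k)) - Rpower N (- (a + INR k)))) d - G +
    (sum_f_R0 (fun k => bernoulli k *
        (rising_coef a k * Rpower N (- (a + INR k)))) d + G)).
  match goal with |- _ = ?x - G + (?y + G) =>
    replace (x - G + (y + G)) with (x + y) by ring end.
  rewrite <- sum_plus. apply sum_eq. intros k _. ring.
Qed.

Lemma telescoping_powers (q : R) : 0 < q ->
  is_series (fun n => Rpower (INR (S (S n)) - 1) (- q)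
                      - Rpower (INR (S (S n))) (- q)) 1.
Proof.
  intros Hq.
  assert (HS : forall n, sum_n (fun n => Rpower (INR (S (S n)) - 1) (- q)
      - Rpower (INR (S (S n))) (- q)) n = 1 - Rpower (INR (S (S n))) (- q)).
  { assert (E : forall n, INR (S (S n)) - 1 = INR (S n))
      by (intros n; rewrite (S_INR (S n)); ring).
    intros n. induction n as [|n IH].
    - rewrite sum_O, E. replace (Rpower (INR 1) (- q)) with 1; [reflexivity|].
      unfold Rpower. simpl. now rewrite ln_1, Rmult_0_r, exp_0.
    - rewrite sum_Sn, IH, E.
      set (p := Rpower (INR (S (S n))) (- q)).
      set (p' := Rpower (INR (S (S (S n)))) (- q)).
      change (1 - p + (p - p') = 1 - p'). ring. }
  apply (is_lim_seq_ext (fun n => 1 - Rpower (INR (S (S n))) (- q)) _ 1).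
  { intros n. now rewrite HS. }
  replace (Finite 1) with (Finite (1 - 0)) by (f_equal; ring).
  apply is_lim_seq_minus'; [apply is_lim_seq_const|].
  apply is_lim_seq_spec. intros eps. assert (He := cond_pos eps).
  destruct (INR_unbounded (exp (- ln eps / q))) as [M HM].
  exists M. intros n Hn. rewrite Rminus_0_r, Rabs_pos_eq
    by apply Rlt_le, exp_pos.
  assert (HMn : INR M <= INR (S (S n))) by (apply le_INR; lia).
  unfold Rpower. rewrite <- (exp_ln eps) by exact He.
  apply exp_increasing.
  assert (Hl : - ln eps / q < ln (INR (S (S n)))).
  { rewrite <- (ln_exp (- ln eps / q)). apply ln_increasing; [apply exp_pos|].
    lra. }
  apply (Rmult_lt_compat_l q) in Hl; [|exact Hq].
  replace (q * (- ln eps / q)) with (- ln eps) in Hl by (field; lra).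
  lra.
Qed.

Open Scope C_scope.

(** * Series of complex numbers *)

Lemma Cminus_plus (x y : C) : x - y + y = x.
Proof. ring. Qed.

Lemma Cmod_minus_sym (x y : C) : Cmod (x - y) = Cmod (y - x).
Proof. rewrite <- Cmod_opp. f_equal. ring. Qed.

Lemma Csum_Sn (a : nat -> C) n : sum_n a (S n) = sum_n a n + a (S n).
Proof. exact (sum_Sn a n). Qed.

Lemma Csum_ext (a b : nat -> C) n :
  (forall k, a k = b k) -> sum_n a n = sum_n b n.
Proof. exact (sum_n_ext a b n). Qed.

Lemma is_series_C_eps (a : nat -> C) (l : C) :
  is_series a l <->
  forall eps : R, (0 < eps)%R ->
    exists N, forall n, (N <= n)%nat -> (Cmod (sum_n a n - l) < eps)%R.
Proof.
  unfold is_series. split.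
  - intros H eps He.
    destruct (proj1 (filterlim_locally_ball_norm (K := C_AbsRing)
                (U := C_NormedModule) _ _) H (mkposreal eps He)) as [N HN].
    exists N. intros n Hn. exact (HN n Hn).
  - intros H. apply (filterlim_locally_ball_norm (K := C_AbsRing)
                (U := C_NormedModule)).
    intros eps. destruct (H eps (cond_pos eps)) as [N HN].
    exists N. intros n Hn. exact (HN n Hn).
Qed.

Lemma is_series_C_ext (a b : nat -> C) (l : C) :
  (forall n, a n = b n) -> is_series a l -> is_series b l.
Proof. exact (is_series_ext a b l). Qed.

Lemma is_series_C_unique (a : nat -> C) (l l' : C) :
  is_series a l -> is_series a l' -> l = l'.
Proof.
  intros H H'. exact (filterlim_locally_unique (sum_n a) l l' H H').
Qed.

Lemma is_series_C_plus (a b : nat -> C) (la lb : C) :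
  is_series a la -> is_series b lb ->
  is_series (fun n => a n + b n) (la + lb).
Proof. exact (is_series_plus a b la lb). Qed.

Lemma is_series_C_scal (c : C) (a : nat -> C) (l : C) :
  is_series a l -> is_series (fun n => c * a n) (c * l).
Proof. exact (is_series_scal_l (V := C_NormedModule) c a l). Qed.

Lemma is_series_C_minus (a b : nat -> C) (la lb : C) :
  is_series a la -> is_series b lb ->
  is_series (fun n => a n - b n) (la - lb).
Proof. exact (is_series_minus a b la lb). Qed.

Lemma is_series_C_cons (a : nat -> C) (l : C) :
  is_series (fun n => a (S n)) l <-> is_series a (a 0%nat + l).
Proof.
  split; intros H.
  - apply (is_series_decr_1 a (a 0%nat + l)).
    change (is_series (fun n => a (S n)) ((a 0%nat + l) + - a 0%nat)).
    now replace (a 0%nat + l + - a 0%nat) with l by ring.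
  - apply (is_series_incr_1 a l).
    change (is_series a (l + a 0%nat)). now rewrite Cplus_comm.
Qed.

Lemma is_series_C_drop (a : nat -> C) (m : nat) (l : C) :
  is_series (fun n => a (S m + n)%nat) l <-> is_series a (sum_n a m + l).
Proof.
  split; intros H.
  - apply (is_series_decr_n a (S m)); [lia|]. simpl Nat.pred.
    change (is_series (fun n => a (S m + n)%nat)
              ((sum_n a m + l) + - sum_n a m)).
    now replace (sum_n a m + l + - sum_n a m) with l by ring.
  - apply (is_series_incr_n a (S m)); [lia|]. simpl Nat.pred.
    change (is_series a (l + sum_n a m)). now rewrite Cplus_comm.
Qed.

Lemma is_series_C_zero (a : nat -> C) :
  (forall n, a n = 0) -> is_series a (RtoC 0).
Proof.
  intros Ha. apply is_series_C_eps. intros eps He. exists 0%nat. intros n _.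
  replace (sum_n a n) with (RtoC 0).
  - unfold Cminus. now rewrite Cplus_opp_r, Cmod_0.
  - induction n as [|n IH].
    + now rewrite sum_O, Ha.
    + now rewrite Csum_Sn, <- IH, Ha, Cplus_0_r.
Qed.

Lemma RtoC_sum_n (a : nat -> R) n :
  sum_n (fun k => RtoC (a k)) n = RtoC (sum_n a n).
Proof.
  induction n as [|n IH].
  - now rewrite !sum_O.
  - rewrite Csum_Sn, IH, sum_Sn. unfold plus; simpl. now rewrite RtoC_plus.
Qed.

Lemma is_series_RtoC (a : nat -> R) (l : R) :
  is_series a l -> is_series (fun n => RtoC (a n)) (RtoC l).
Proof.
  intros H. apply is_series_C_eps. intros eps He.
  destruct (proj1 (filterlim_locally_ball_norm (sum_n a) l) H
              (mkposreal eps He)) as [N HN].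
  exists N. intros n Hn. rewrite RtoC_sum_n, <- RtoC_minus, Cmod_R.
  exact (HN n Hn).
Qed.

Lemma Cmod_sum_le (a : nat -> C) n :
  (Cmod (sum_n a n) <= sum_f_R0 (fun k => Cmod (a k)) n)%R.
Proof.
  induction n as [|n IH].
  - rewrite sum_O. simpl. lra.
  - rewrite Csum_Sn. simpl.
    eapply Rle_trans; [apply Cmod_triangle|]. lra.
Qed.

Lemma sum_le_Series (u : nat -> R) n :
  (forall k, (0 <= u k)%R) -> ex_series u -> (sum_f_R0 u n <= Series u)%R.
Proof.
  intros Hp [l Hl]. rewrite (is_series_unique _ _ Hl).
  apply (is_lim_seq_incr_compare (fun n => sum_f_R0 u n)).
  - apply is_lim_seq_ext with (2 := Hl). intros; apply sum_n_Reals.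
  - intros k. simpl. specialize (Hp (S k)). lra.
Qed.

Lemma ex_series_bounded (u : nat -> R) (M : R) :
  (forall k, (0 <= u k)%R) -> (forall K, (sum_f_R0 u K <= M)%R) ->
  ex_series u /\ (Series u <= M)%R.
Proof.
  intros Hp HM.
  destruct (ex_finite_lim_seq_incr (fun n => sum_f_R0 u n) M) as [l Hl].
  - intros k. simpl. specialize (Hp (S k)). lra.
  - exact HM.
  - assert (H : is_series u l).
    { apply (is_lim_seq_ext (fun n => sum_f_R0 u n) (sum_n u) l); [|exact Hl].
      intros; symmetry; apply sum_n_Reals. }
    split; [now exists l|].
    rewrite (is_series_unique _ _ H).
    apply (is_lim_seq_le (fun n => sum_f_R0 u n) (fun _ => M) l M HM Hl).
    apply is_lim_seq_const.
Qed.

Lemma is_lim_seq_Cmod (a : nat -> C) (l : C) :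
  is_series a l -> is_lim_seq (fun n => Cmod (sum_n a n)) (Cmod l).
Proof.
  intros H. apply is_lim_seq_spec. intros eps.
  destruct (proj1 (is_series_C_eps _ _) H eps (cond_pos eps)) as [N HN].
  exists N. intros n Hn. apply Rle_lt_trans with (2 := HN n Hn).
  assert (H1 := Cmod_triangle (sum_n a n - l) l).
  assert (H2 := Cmod_triangle (l - sum_n a n) (sum_n a n)).
  rewrite Cminus_plus in H1. rewrite Cminus_plus, Cmod_minus_sym in H2.
  apply Rabs_le. lra.
Qed.

Lemma Cmod_series_le (a : nat -> C) (l : C) (M : R) :
  is_series a l -> (forall K, (sum_f_R0 (fun k => Cmod (a k)) K <= M)%R) ->
  (Cmod l <= M)%R.
Proof.
  intros H HM.
  apply (is_lim_seq_le (fun n => Cmod (sum_n a n)) (fun _ => M) (Cmod l) M).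
  - intros n. eapply Rle_trans; [apply Cmod_sum_le|apply HM].
  - now apply is_lim_seq_Cmod.
  - apply is_lim_seq_const.
Qed.

Lemma ex_series_C_dominated (a : nat -> C) (M : nat -> R) :
  (forall k, (Cmod (a k) <= M k)%R) -> ex_series M -> exists l, is_series a l.
Proof.
  intros H HM.
  exact (ex_series_le (V := C_CompleteNormedModule) a M H HM).
Qed.

Lemma ex_series_C_abs (a : nat -> C) (M : R) :
  (forall K, (sum_f_R0 (fun k => Cmod (a k)) K <= M)%R) ->
  exists l, is_series a l.
Proof.
  intros HM. apply ex_series_C_dominated with (fun k => Cmod (a k)).
  - intros; lra.
  - apply (ex_series_bounded _ M); [intros; apply Cmod_ge_0|exact HM].
Qed.

Lemma Cmod_series_tail_le (a : nat -> C) (l : C) (M : nat -> R) (n : nat) :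
  (forall k, (Cmod (a k) <= M k)%R) -> ex_series M -> is_series a l ->
  (Cmod (l - sum_n a n) <= Series M - sum_f_R0 M n)%R.
Proof.
  intros Ha HM Hl.
  assert (Hp : forall k, (0 <= M k)%R)
    by (intros k; eapply Rle_trans; [apply Cmod_ge_0|apply Ha]).
  apply Cmod_series_le with (fun k => a (S n + k)%nat).
  - apply is_series_C_drop.
    now rewrite Cplus_comm, Cminus_plus.
  - intros K.
    apply Rle_trans with (sum_f_R0 (fun k => M (S n + k)%nat) K).
    + apply sum_Rle. intros k _. apply Ha.
    + assert (E := tech2 M n (S n + K)).
      specialize (E ltac:(lia)).
      replace (S n + K - S n)%nat with K in E by lia.
      assert (H := sum_le_Series M (S n + K) Hp HM).
      rewrite E in H. lra.
Qed.

(** Tannery's theorem: a summable majorant reduces the limit of the sums to a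
    limit of finitely many terms. *)
Lemma tannery (d : nat -> nat -> C) (D : nat -> C) (M : nat -> R) :
  (forall K i, (Cmod (d K i) <= M i)%R) -> ex_series M ->
  (forall i (eps : R), (0 < eps)%R ->
     exists N, forall K, (N <= K)%nat -> (Cmod (d K i) < eps)%R) ->
  (forall K, is_series (d K) (D K)) ->
  forall eps : R, (0 < eps)%R ->
    exists N, forall K, (N <= K)%nat -> (Cmod (D K) < eps)%R.
Proof.
  intros Hd HM H0 HD eps He.
  assert (HI : exists I, (Series M - sum_f_R0 M I < eps / 2)%R).
  { assert (HL := Series_correct M HM).
    assert (He2 : (0 < eps / 2)%R) by lra.
    destruct (proj1 (filterlim_locally_ball_norm (sum_n M) _) HL
                (mkposreal _ He2)) as [I HI].
    exists I. specialize (HI I (le_n I)).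
    unfold ball_norm, norm, minus, plus, opp in HI; simpl in HI.
    rewrite sum_n_Reals in HI. apply Rabs_def2 in HI. lra. }
  destruct HI as [I HI].
  assert (HF : forall I (e : R), (0 < e)%R ->
     exists N, forall K, (N <= K)%nat -> (Cmod (sum_n (d K) I) < e)%R).
  { clear I HI. intros I. induction I as [|I IH]; intros e Hpe.
    - destruct (H0 0%nat e Hpe) as [N HN]. exists N. intros K HK.
      rewrite sum_O. now apply HN.
    - destruct (H0 (S I) (e / 2)%R) as [N1 HN1]; [lra|].
      destruct (IH (e / 2)%R) as [N2 HN2]; [lra|].
      exists (N1 + N2)%nat. intros K HK. rewrite Csum_Sn.
      assert (H1 := HN1 K ltac:(lia)). assert (H2 := HN2 K ltac:(lia)).
      eapply Rle_lt_trans; [apply Cmod_triangle|]. lra. }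
  destruct (HF I (eps / 2)%R) as [N HN]; [lra|].
  exists N. intros K HK. specialize (HN K HK).
  assert (HT := Cmod_series_tail_le (d K) (D K) M I (Hd K) HM (HD K)).
  rewrite <- (Cminus_plus (D K) (sum_n (d K) I)).
  eapply Rle_lt_trans; [apply Cmod_triangle|]. lra.
Qed.

(** The difference between the sum of the rows and the [K]-th partial sum of
    the columns is the series of the row remainders, to which Tannery's theorem
    applies. *)
Lemma fubini_series (a : nat -> nat -> C) (r b : nat -> C) (M : nat -> R) :
  (forall i K, (sum_f_R0 (fun k => Cmod (a i k)) K <= M i)%R) ->
  ex_series M ->
  (forall i, is_series (a i) (r i)) ->
  (forall k, is_series (fun i => a i k) (b k)) ->
  exists L, is_series r L /\ is_series b L /\
    (forall K, (sum_f_R0 (fun k => Cmod (b k)) K <= Series M)%R).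
Proof.
  intros HaM HM Hr Hb.
  assert (HrM : forall i, (Cmod (r i) <= M i)%R)
    by (intros i; apply Cmod_series_le with (a i); auto).
  assert (Hp : forall i, (0 <= M i)%R)
    by (intros i; eapply Rle_trans; [apply Cmod_ge_0|apply HrM]).
  destruct (ex_series_C_dominated r M HrM HM) as [L HL].
  exists L. split; [exact HL|]. split.
  - assert (Hcols : forall K,
      is_series (fun i => sum_n (a i) K) (sum_n b K)).
    { induction K as [|K IH].
      - rewrite sum_O. apply is_series_C_ext with (2 := Hb 0%nat).
        intros i. now rewrite sum_O.
      - rewrite Csum_Sn.
        apply is_series_C_ext with (2 := is_series_C_plus _ _ _ _ IH (Hb (S K))).
        intros i. now rewrite Csum_Sn. }
    apply is_series_C_eps. intros eps He.
    destruct (tannery (fun K i => r i - sum_n (a i) K)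
                (fun K => L - sum_n b K) (fun i => (2 * M i)%R))
      with (eps := eps) as [N HN].
    + intros K i. eapply Rle_trans; [apply Cmod_triangle|].
      rewrite Cmod_opp. assert (H1 := HrM i).
      assert (H2 := Cmod_sum_le (a i) K). assert (H3 := HaM i K). lra.
    + apply (ex_series_scal_l (K := R_AbsRing) 2%R M HM).
    + intros i e Hpe.
      destruct (proj1 (is_series_C_eps _ _) (Hr i) e Hpe) as [N HN].
      exists N. intros K HK.
      rewrite Cmod_minus_sym. now apply HN.
    + intros K. apply is_series_C_minus; [exact HL|apply Hcols].
    + exact He.
    + exists N. intros K HK.
      rewrite Cmod_minus_sym. now apply HN.
  - intros K.
    assert (Hlim : is_lim_seq
       (fun I => sum_f_R0 (fun k => Cmod (sum_n (fun i => a i k) I)) K)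
       (sum_f_R0 (fun k => Cmod (b k)) K)).
    { induction K as [|K IH]; simpl.
      - apply is_lim_seq_Cmod, Hb.
      - apply is_lim_seq_plus'; [exact IH|]. apply is_lim_seq_Cmod, Hb. }
    apply (is_lim_seq_le _ (fun _ => Series M) _ (Series M)) with (2 := Hlim).
    2: apply is_lim_seq_const.
    intros I. eapply Rle_trans; [|apply (sum_le_Series M I Hp HM)].
    induction I as [|I IH].
    + simpl. eapply Rle_trans; [|apply (HaM 0%nat K)].
      apply sum_Rle. intros k _. rewrite sum_O. lra.
    + simpl. eapply Rle_trans; [|apply Rplus_le_compat;
        [exact IH|apply (HaM (S I) K)]].
      rewrite <- sum_plus. apply sum_Rle. intros k _.
      rewrite Csum_Sn. apply Cmod_triangle.
Qed.

Lemma sum_f_R0_shift_le (u : nat -> R) (m K : nat) :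
  (forall k, (0 <= u k)%R) ->
  (sum_f_R0 (fun k => u (m + k)%nat) K <= sum_f_R0 u (m + K))%R.
Proof.
  intros Hp. induction K as [|K IH].
  - simpl. rewrite Nat.add_0_r. destruct m as [|m]; simpl; [lra|].
    assert (0 <= sum_f_R0 u m)%R by now apply cond_pos_sum. lra.
  - rewrite Nat.add_succ_r. simpl. rewrite Nat.add_succ_r. lra.
Qed.

(** * The complex exponential *)

Lemma exp_partial_le (c : R) K :
  (0 <= c)%R -> (sum_f_R0 (fun k => c ^ k / INR (fact k))%R K <= exp c)%R.
Proof.
  intros Hc.
  assert (H : is_series (fun k => c ^ k / INR (fact k))%R (exp c)).
  { apply is_series_ext with (fun k => / INR (fact k) * c ^ k)%R.
    - intros n. unfold Rdiv. apply Rmult_comm.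
    - exact (proj1 (is_pseries_R _ c (exp c)) (is_exp_Reals c)). }
  rewrite <- (is_series_unique _ _ H). apply sum_le_Series.
  - intros k. apply Rmult_le_pos; [now apply pow_le|].
    apply Rlt_le, Rinv_0_lt_compat, INR_fact_lt_0.
  - now exists (exp c).
Qed.

Lemma Cmod_exp_term (z : C) k :
  Cmod (z ^ k / INR (fact k)) = (Cmod z ^ k / INR (fact k))%R.
Proof.
  assert (H := INR_fact_lt_0 k).
  rewrite Cmod_div, Cmod_pow, Cmod_R, Rabs_pos_eq; [reflexivity|lra|].
  intros E. apply RtoC_inj in E. lra.
Qed.

Lemma Re_sum_n (a : nat -> C) n : Re (sum_n a n) = sum_n (fun k => Re (a k)) n.
Proof.
  induction n as [|n IH].
  - now rewrite !sum_O.
  - rewrite Csum_Sn, sum_Sn, <- IH. reflexivity.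
Qed.

Lemma Im_sum_n (a : nat -> C) n : Im (sum_n a n) = sum_n (fun k => Im (a k)) n.
Proof.
  induction n as [|n IH].
  - now rewrite !sum_O.
  - rewrite Csum_Sn, sum_Sn, <- IH. reflexivity.
Qed.

Lemma im_le_Cmod (z : C) : (Rabs (Im z) <= Cmod z)%R.
Proof. eapply Rle_trans; [apply Rmax_r|apply Rmax_Cmod]. Qed.

Lemma is_series_Re_Im (a : nat -> C) (l : C) :
  is_series a l ->
  is_series (fun k => Re (a k)) (Re l) /\ is_series (fun k => Im (a k)) (Im l).
Proof.
  intros H.
  split; apply (filterlim_locally_ball_norm (K := R_AbsRing)
                  (U := R_NormedModule)); intros eps;
    destruct (proj1 (is_series_C_eps _ _) H eps (cond_pos eps)) as [N HN];
    exists N; intros n Hn; specialize (HN n Hn);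
    apply Rle_lt_trans with (2 := HN).
  - rewrite <- Re_sum_n. exact (re_le_Cmod (sum_n a n - l)).
  - rewrite <- Im_sum_n. exact (im_le_Cmod (sum_n a n - l)).
Qed.

(** The real and imaginary parts [A], [B] of [sum (t z) ^ k / k!], as functions
    of real [t], solve [A' = x A - y B], [B' = y A + x B]; hence
    [exp (- x t) (A cos y t + B sin y t)] and
    [exp (- x t) (B cos y t - A sin y t)] are constant. *)
Lemma Cexp_series (z : C) :
  is_series (fun k => z ^ k / INR (fact k)) (Cexp z).
Proof.
  set (x := Re z). set (y := Im z).
  set (a := fun k => (Re (z ^ k) / INR (fact k))%R).
  set (b := fun k => (Im (z ^ k) / INR (fact k))%R).
  assert (Hz : forall k, z ^ k / INR (fact k) = (a k, b k)).
  { intros k. assert (H := INR_fact_lt_0 k).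
    unfold Cdiv. rewrite <- RtoC_inv by lra.
    unfold a, b. apply injective_projections; simpl; unfold Re, Im; field; lra. }
  assert (Habs : forall (u : nat -> R),
    (forall k, (Rabs (u k) <= Cmod z ^ k / INR (fact k))%R) ->
    CV_radius u = p_infty).
  { intros u Hu. destruct (CV_radius u) as [c| |] eqn:Ec.
    - exfalso.
      assert (H := proj1 (CV_radius_bounded u) (Rabs c + 1)%R).
      assert (Hb : exists M, forall n, (Rabs (u n * (Rabs c + 1) ^ n) <= M)%R).
      { exists (exp (Cmod z * (Rabs c + 1))). intros n.
        assert (Hc := Rabs_pos c). assert (Hz0 := Cmod_ge_0 z).
        rewrite Rabs_mult, (Rabs_pos_eq ((Rabs c + 1) ^ n))
          by (apply pow_le; lra).
        apply Rle_trans with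
          ((Cmod z * (Rabs c + 1)) ^ n / INR (fact n))%R.
        - rewrite Rpow_mult_distr.
          replace (Cmod z ^ n * (Rabs c + 1) ^ n / INR (fact n))%R
            with (Cmod z ^ n / INR (fact n) * (Rabs c + 1) ^ n)%R
            by (field; apply INR_fact_neq_0).
          apply Rmult_le_compat_r; [apply pow_le; lra|apply Hu].
        - eapply Rle_trans; [|apply (exp_partial_le _ n); nra].
          assert (H1 : forall k, (0 <=
             (Cmod z * (Rabs c + 1)) ^ k / INR (fact k))%R).
          { intros k. apply Rmult_le_pos; [apply pow_le; nra|].
            apply Rlt_le, Rinv_0_lt_compat, INR_fact_lt_0. }
          assert (H2 := sum_f_R0_shift_le _ n 0 H1). simpl sum_f_R0 in H2.
          rewrite Nat.add_0_r in H2. exact H2. }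
      specialize (H Hb). rewrite Ec in H. simpl in H.
      assert (H3 := Rle_abs c). lra.
    - reflexivity.
    - exfalso. assert (H := CV_radius_ge_0 u). rewrite Ec in H. exact H. }
  assert (Hab : forall k, (Rabs (a k) <= Cmod z ^ k / INR (fact k))%R /\
                          (Rabs (b k) <= Cmod z ^ k / INR (fact k))%R).
  { intros k. rewrite <- Cmod_exp_term, Hz. split.
    - apply (re_le_Cmod (a k, b k)).
    - apply (im_le_Cmod (a k, b k)). }
  assert (Ra := Habs a (fun k => proj1 (Hab k))).
  assert (Rb := Habs b (fun k => proj2 (Hab k))).
  assert (Ha : forall t, is_series (fun n => a n * t ^ n)%R (PSeries a t)).
  { intros t. apply Series_correct, (proj1 (ex_pseries_R a t)).
    apply CV_radius_inside. now rewrite Ra. }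
  assert (Hb : forall t, is_series (fun n => b n * t ^ n)%R (PSeries b t)).
  { intros t. apply Series_correct, (proj1 (ex_pseries_R b t)).
    apply CV_radius_inside. now rewrite Rb. }
  assert (HS : forall n, INR (fact (S n)) = (INR (S n) * INR (fact n))%R)
    by (intros n; now rewrite fact_simpl, mult_INR).
  assert (HSn : forall n, INR (S n) <> 0%R)
    by (intros n; apply not_0_INR; discriminate).
  assert (Da : forall t, is_derive (PSeries a) t
                 (x * PSeries a t - y * PSeries b t)%R).
  { intros t.
    replace (x * PSeries a t - y * PSeries b t)%R
      with (PSeries (PS_derive a) t);
      [apply is_derive_PSeries; now rewrite Ra|].
    apply is_series_unique.
    apply is_series_ext with
      (2 := is_series_minus _ _ _ _
              (is_series_scal_l x _ _ (Ha t)) (is_series_scal_l y _ _ (Hb t))).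
    intros n. change ((x * (a n * t ^ n)) + - (y * (b n * t ^ n))
                      = INR (S n) * a (S n) * t ^ n)%R.
    unfold a, b. rewrite HS.
    change (Re (z ^ S n)) with (x * Re (z ^ n) - y * Im (z ^ n))%R.
    field. split; [apply INR_fact_neq_0|apply HSn]. }
  assert (Db : forall t, is_derive (PSeries b) t
                 (x * PSeries b t + y * PSeries a t)%R).
  { intros t.
    replace (x * PSeries b t + y * PSeries a t)%R
      with (PSeries (PS_derive b) t);
      [apply is_derive_PSeries; now rewrite Rb|].
    apply is_series_unique.
    apply is_series_ext with
      (2 := is_series_plus _ _ _ _
              (is_series_scal_l x _ _ (Hb t)) (is_series_scal_l y _ _ (Ha t))).
    intros n. change ((x * (b n * t ^ n)) + (y * (a n * t ^ n))
                      = INR (S n) * b (S n) * t ^ n)%R.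
    unfold a, b. rewrite HS.
    change (Im (z ^ S n)) with (x * Im (z ^ n) + y * Re (z ^ n))%R.
    field. split; [apply INR_fact_neq_0|apply HSn]. }
  set (A := PSeries a) in *. set (B := PSeries b) in *.
  assert (A0 : A 0%R = 1%R).
  { unfold A. rewrite PSeries_0. unfold a. simpl. field. }
  assert (B0 : B 0%R = 0%R).
  { unfold B. rewrite PSeries_0. unfold b. simpl. field. }
  assert (DA : forall t, Derive (fun u => A u) t = (x * A t - y * B t)%R)
    by (intros t; exact (is_derive_unique _ _ _ (Da t))).
  assert (DB : forall t, Derive (fun u => B u) t = (x * B t + y * A t)%R)
    by (intros t; exact (is_derive_unique _ _ _ (Db t))).
  assert (EP : (exp (- x * 0) * (A 0 * cos (y * 0) + B 0 * sin (y * 0))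
                = exp (- x * 1) * (A 1 * cos (y * 1) + B 1 * sin (y * 1)))%R).
  { apply (eq_is_derive
      (fun t => exp (- x * t) * (A t * cos (y * t) + B t * sin (y * t)))%R);
      [|lra].
    intros t _. auto_derive.
    - repeat split; eexists; [apply Da|apply Db].
    - rewrite DA, DB.
      change (@zero _) with 0%R. ring. }
  assert (EQ : (exp (- x * 0) * (B 0 * cos (y * 0) - A 0 * sin (y * 0))
                = exp (- x * 1) * (B 1 * cos (y * 1) - A 1 * sin (y * 1)))%R).
  { apply (eq_is_derive
      (fun t => exp (- x * t) * (B t * cos (y * t) - A t * sin (y * t)))%R);
      [|lra].
    intros t _. auto_derive.
    - repeat split; eexists; [apply Db|apply Da].
    - rewrite DA, DB.
      change (@zero _) with 0%R. ring. }
  rewrite A0, B0, !Rmult_0_r, !Rmult_1_r, cos_0, sin_0, exp_0 in EP, EQ.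
  assert (Hx : (exp x * exp (- x) = 1)%R)
    by (rewrite <- exp_plus, Rplus_opp_r; apply exp_0).
  assert (Hsc := sin2_cos2 y). unfold Rsqr in Hsc.
  assert (EA : A 1%R = (exp x * cos y)%R).
  { replace (A 1%R) with
      ((exp x * exp (- x)) * A 1 * (sin y * sin y + cos y * cos y))%R
      by (rewrite Hx, Hsc; ring).
    transitivity (exp x * (cos y * (exp (- x) * (A 1 * cos y + B 1 * sin y))
                - sin y * (exp (- x) * (B 1 * cos y - A 1 * sin y))))%R;
      [ring|rewrite <- EP, <- EQ; ring]. }
  assert (EB : B 1%R = (exp x * sin y)%R).
  { replace (B 1%R) with
      ((exp x * exp (- x)) * B 1 * (sin y * sin y + cos y * cos y))%R
      by (rewrite Hx, Hsc; ring).
    transitivity (exp x * (sin y * (exp (- x) * (A 1 * cos y + B 1 * sin y))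
                + cos y * (exp (- x) * (B 1 * cos y - A 1 * sin y))))%R;
      [ring|rewrite <- EP, <- EQ; ring]. }
  destruct (ex_series_C_abs (fun k => z ^ k / INR (fact k)) (exp (Cmod z)))
    as [l Hl].
  { intros K. eapply Rle_trans; [|apply (exp_partial_le _ K), Cmod_ge_0].
    apply sum_Rle. intros k _. rewrite Cmod_exp_term. lra. }
  replace (Cexp z) with l; [exact Hl|].
  destruct (is_series_Re_Im _ _ Hl) as [H1 H2].
  assert (HR : Re l = A 1%R).
  { rewrite <- (is_series_unique _ _ H1), <- (is_series_unique _ _ (Ha 1%R)).
    apply Series_ext. intros n. rewrite Hz, pow1, Rmult_1_r. reflexivity. }
  assert (HI : Im l = B 1%R).
  { rewrite <- (is_series_unique _ _ H2), <- (is_series_unique _ _ (Hb 1%R)).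
    apply Series_ext. intros n. rewrite Hz, pow1, Rmult_1_r. reflexivity. }
  unfold Cexp. fold x y. apply injective_projections; simpl.
  - change (fst l) with (Re l). rewrite HR, EA. ring.
  - change (snd l) with (Im l). rewrite HI, EB. ring.
Qed.

Lemma Cexp_plus (z w : C) : Cexp (z + w) = Cexp z * Cexp w.
Proof.
  unfold Cexp.
  change (Re (z + w)) with (Re z + Re w)%R.
  change (Im (z + w)) with (Im z + Im w)%R.
  rewrite exp_plus, cos_plus, sin_plus.
  apply injective_projections; simpl; ring.
Qed.

Lemma Cmod_Cexp (z : C) : Cmod (Cexp z) = exp (Re z).
Proof.
  unfold Cexp.
  rewrite Cmod_mult, Cmod_R, Rabs_pos_eq by (apply Rlt_le, exp_pos).
  replace (Cmod _) with 1%R; [ring|].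
  unfold Cmod; simpl.
  match goal with |- _ = sqrt ?u => replace u with 1%R end.
  - now rewrite sqrt_1.
  - assert (H := sin2_cos2 (Im z)). unfold Rsqr in H. nra.
Qed.

Lemma Rcpow_RtoC (x u : R) : Rcpow x (RtoC u) = RtoC (Rpower x u).
Proof.
  unfold Rcpow, Cexp, Rpower. rewrite <- RtoC_mult.
  change (Re (RtoC (u * ln x))) with (u * ln x)%R.
  change (Im (RtoC (u * ln x))) with 0%R.
  rewrite cos_0, sin_0. ring.
Qed.

Lemma ln_ge_0 (x : R) : (1 <= x)%R -> (0 <= ln x)%R.
Proof.
  intros Hx. rewrite <- ln_1. destruct (Rle_lt_or_eq_dec _ _ Hx) as [H|<-].
  - apply Rlt_le, ln_increasing; lra.
  - lra.
Qed.

(** * Absolutely convergent power series on a closed disc *)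

(** The radius and the norm are explicit because sums of infinitely many
    functions need a common disc and summable norms. *)
Definition wiener (f : C -> C) (z0 : C) (r M : R) : Prop :=
  exists a : nat -> C,
    (forall K, (sum_f_R0 (fun k => Cmod (a k) * r ^ k) K <= M)%R) /\
    (forall w, (Cmod w <= r)%R -> is_series (fun k => a k * w ^ k) (f (z0 + w))).

Definition wiener_at (f : C -> C) (z0 : C) : Prop :=
  exists r M : R, (0 < r)%R /\ wiener f z0 r M.

Lemma pow_n_Cpow (w : C) n : pow_n (K := C_Ring) w n = w ^ n.
Proof. induction n as [|n IH]; simpl; [reflexivity|now rewrite IH]. Qed.

Lemma sum_f_R0_geom_half (c : R) K :
  sum_f_R0 (fun k => c * (/ 2) ^ k)%R K = (c * (2 - (/ 2) ^ K))%R.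
Proof.
  induction K as [|K IH]; simpl; [lra|]. rewrite IH. simpl. lra.
Qed.

(** Convergence at one point bounds the coefficients geometrically; halving
    the radius then makes the series absolutely convergent. *)
Lemma analytic_at_wiener (f : C -> C) (z0 : C) :
  analytic_at f z0 -> wiener_at f z0.
Proof.
  intros [a [e He]].
  assert (He0 := cond_pos e).
  assert (H : forall w : C, (Cmod w < e)%R ->
            is_series (fun k => a k * w ^ k) (f (z0 + w))).
  { intros w Hw.
    assert (Hs : is_pseries a ((z0 + w) - z0) (f (z0 + w))).
    { apply He. apply C_NormedModule_mixin_compat1.
      change (minus (z0 + w) z0) with ((z0 + w) - z0).
      now replace (z0 + w - z0) with w by ring. }
    replace (z0 + w - z0) with w in Hs by ring.
    apply is_series_C_ext with (2 := Hs). intros n.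
    rewrite pow_n_Cpow. apply Cmult_comm. }
  (* One evaluation point inside the disc, here at distance [e / 2], is enough
     to bound the coefficients. *)
  set (rho := (e / 2)%R).
  assert (Hrho : (0 < rho)%R) by (unfold rho; lra).
  assert (Hs := H (RtoC rho)).
  rewrite Cmod_R, Rabs_pos_eq in Hs by lra.
  specialize (Hs ltac:(unfold rho; lra)).
  destruct (filterlim_bounded (K := C_AbsRing) (V := C_NormedModule)
              (sum_n (fun k => a k * RtoC rho ^ k))
              (ex_intro _ _ Hs)) as [B HB].
  assert (Ha : forall k, (Cmod (a k) * rho ^ k <= 2 * B)%R).
  { intros k.
    assert (E : (Cmod (a k) * rho ^ k)%R = Cmod (a k * RtoC rho ^ k)).
    { rewrite Cmod_mult, Cmod_pow, Cmod_R, Rabs_pos_eq by lra. reflexivity. }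
    rewrite E.
    destruct k as [|k].
    - assert (H0 := HB 0%nat). rewrite sum_O in H0.
      change (Cmod (a 0%nat * RtoC rho ^ 0) <= B)%R in H0.
      assert (H1 := Cmod_ge_0 (a 0%nat * RtoC rho ^ 0)). lra.
    - assert (H0 := HB (S k)). assert (H1 := HB k).
      change (Cmod (sum_n (fun k => (a k * RtoC rho ^ k)%C) (S k)) <= B)%R in H0.
      change (Cmod (sum_n (fun k => (a k * RtoC rho ^ k)%C) k) <= B)%R in H1.
      rewrite Csum_Sn in H0.
      set (x := sum_n (fun k => a k * RtoC rho ^ k) k : C) in *.
      set (y := a (S k) * RtoC rho ^ S k) in *.
      replace y with ((x + y) - x) by ring.
      eapply Rle_trans; [apply Cmod_triangle|]. rewrite Cmod_opp. lra. }
  exists (rho / 2)%R, (4 * B)%R. split; [lra|].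
  exists a. split.
  - intros K.
    apply Rle_trans with (sum_f_R0 (fun k => (2 * B) * (/ 2) ^ k)%R K).
    + apply sum_Rle. intros k _.
      unfold Rdiv. rewrite Rpow_mult_distr, <- Rmult_assoc.
      apply Rmult_le_compat_r; [apply pow_le; lra|apply Ha].
    + rewrite sum_f_R0_geom_half.
      assert (0 < (/ 2) ^ K)%R by (apply pow_lt; lra).
      assert (0 <= B)%R by (assert (HB0 := Ha 0%nat); simpl in HB0;
        assert (HB1 := Cmod_ge_0 (a 0%nat)); lra).
      nra.
  - intros w Hw. apply H. unfold rho in *. lra.
Qed.

Lemma wiener_term_nonneg (a : nat -> C) (r : R) k :
  (0 <= r)%R -> (0 <= Cmod (a k) * r ^ k)%R.
Proof.
  intros Hr. apply Rmult_le_pos; [apply Cmod_ge_0|now apply pow_le].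
Qed.

Lemma wiener_shrink (f : C -> C) (z0 : C) (r r' M : R) :
  (0 <= r' <= r)%R -> wiener f z0 r M -> wiener f z0 r' M.
Proof.
  intros Hr [a [Ha Hf]]. exists a. split.
  - intros K. eapply Rle_trans; [|apply (Ha K)]. apply sum_Rle. intros k _.
    apply Rmult_le_compat_l; [apply Cmod_ge_0|now apply pow_incr].
  - intros w Hw. apply Hf. lra.
Qed.

Lemma wiener_ext (f g : C -> C) (z0 : C) (r M : R) :
  (forall z, f z = g z) -> wiener f z0 r M -> wiener g z0 r M.
Proof.
  intros E [a [Ha Hf]]. exists a. split; [exact Ha|].
  intros w Hw. rewrite <- E. now apply Hf.
Qed.

Lemma wiener_bound (f : C -> C) (z0 : C) (r M : R) (w : C) :
  wiener f z0 r M -> (Cmod w <= r)%R -> (Cmod (f (z0 + w)%C) <= M)%R.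
Proof.
  intros [a [Ha Hf]] Hw.
  apply Cmod_series_le with (1 := Hf w Hw).
  intros K. eapply Rle_trans; [|apply (Ha K)]. apply sum_Rle. intros k _.
  rewrite Cmod_mult, Cmod_pow.
  apply Rmult_le_compat_l; [apply Cmod_ge_0|].
  apply pow_incr. split; [apply Cmod_ge_0|exact Hw].
Qed.

Lemma wiener_const (c z0 : C) (r : R) : wiener (fun _ => c) z0 r (Cmod c).
Proof.
  exists (fun k => match k with O => c | S _ => RtoC 0 end). split.
  - intros K. apply Req_le.
    induction K as [|K IH]; simpl; [ring|]. rewrite IH, Cmod_0. ring.
  - intros w _.
    cut (is_series (fun k => match k with O => c | S _ => RtoC 0 end * w ^ k)
           (c * w ^ 0 + 0)).
    { now replace (c * w ^ 0 + 0) with c by (simpl; ring). }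
    apply (is_series_C_cons
             (fun k => match k with O => c | S _ => RtoC 0 end * w ^ k)).
    apply is_series_C_zero. intros n. ring.
Qed.

Lemma wiener_plus (f g : C -> C) (z0 : C) (r M N : R) :
  (0 <= r)%R -> wiener f z0 r M -> wiener g z0 r N ->
  wiener (fun z => f z + g z) z0 r (M + N).
Proof.
  intros Hr [a [Ha Hf]] [b [Hb Hg]]. exists (fun k => a k + b k). split.
  - intros K. eapply Rle_trans;
      [|apply Rplus_le_compat; [apply (Ha K)|apply (Hb K)]].
    rewrite <- sum_plus. apply sum_Rle. intros k _.
    rewrite <- Rmult_plus_distr_r.
    apply Rmult_le_compat_r; [now apply pow_le|apply Cmod_triangle].
  - intros w Hw.
    apply is_series_C_ext with
      (2 := is_series_C_plus _ _ _ _ (Hf w Hw) (Hg w Hw)).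
    intros n. ring.
Qed.

Lemma wiener_scal (c : C) (f : C -> C) (z0 : C) (r M : R) :
  wiener f z0 r M -> wiener (fun z => c * f z) z0 r (Cmod c * M).
Proof.
  intros [a [Ha Hf]]. exists (fun k => c * a k). split.
  - intros K. eapply Rle_trans;
      [|apply Rmult_le_compat_l; [apply Cmod_ge_0|apply (Ha K)]].
    rewrite scal_sum. apply sum_Rle. intros k _.
    rewrite Cmod_mult. lra.
  - intros w Hw.
    apply is_series_C_ext with (2 := is_series_C_scal c _ _ (Hf w Hw)).
    intros n. ring.
Qed.

Lemma wiener_shift (c : C) (f : C -> C) (z0 : C) (r M : R) :
  wiener f (z0 + c) r M -> wiener (fun z => f (z + c)) z0 r M.
Proof.
  intros [a [Ha Hf]]. exists a. split; [exact Ha|].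
  intros w Hw. replace (z0 + w + c) with (z0 + c + w) by ring. now apply Hf.
Qed.

Lemma wiener_mul_id (f : C -> C) (z0 : C) (r M : R) :
  (0 <= r)%R -> wiener f z0 r M ->
  wiener (fun z => (z - z0) * f z) z0 r (r * M).
Proof.
  intros Hr [a [Ha Hf]].
  exists (fun k => match k with O => RtoC 0 | S j => a j end). split.
  - intros K. destruct K as [|K].
    + simpl. rewrite Cmod_0. assert (H := Ha 0%nat). simpl in H.
      assert (H1 := Cmod_ge_0 (a 0%nat)). nra.
    + rewrite decomp_sum by lia. simpl Nat.pred. rewrite Cmod_0.
      eapply Rle_trans; [|apply Rmult_le_compat_l; [exact Hr|apply (Ha K)]].
      rewrite scal_sum.
      rewrite Rmult_0_l, Rplus_0_l. apply sum_Rle. intros k _. simpl. lra.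
  - intros w Hw. replace (z0 + w - z0) with w by ring.
    replace (w * f (z0 + w)) with (0 * w ^ 0 + w * f (z0 + w)) by ring.
    apply (is_series_C_cons
             (fun k => match k with O => RtoC 0 | S j => a j end * w ^ k)).
    apply is_series_C_ext with (2 := is_series_C_scal w _ _ (Hf w Hw)).
    intros n. simpl. ring.
Qed.

Lemma wiener_mul_affine (c : C) (f : C -> C) (z0 : C) (r M : R) :
  (0 <= r)%R -> wiener f z0 r M ->
  wiener (fun z => (z + c) * f z) z0 r ((Cmod (z0 + c) + r) * M).
Proof.
  intros Hr Hf.
  rewrite Rmult_plus_distr_r.
  apply wiener_ext with (fun z => (z0 + c) * f z + (z - z0) * f z).
  { intros z. ring. }
  apply wiener_plus; [exact Hr|now apply wiener_scal|now apply wiener_mul_id].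
Qed.

(** The coefficients of the sum are the sums of the coefficients: both orders
    of summation of the double series agree on the whole disc. *)
Lemma wiener_series (f : nat -> C -> C) (g : C -> C) (z0 : C) (r : R)
    (M : nat -> R) :
  (0 < r)%R ->
  (forall i, wiener (f i) z0 r (M i)) -> ex_series M ->
  (forall z, (Cmod (z - z0) <= r)%R -> is_series (fun i => f i z) (g z)) ->
  wiener g z0 r (Series M).
Proof.
  intros Hr Hf HM Hg.
  destruct (functional_choice _ Hf) as [a Ha]. clear Hf.
  assert (Hrk : forall k, (0 < r ^ k)%R) by (intros k; now apply pow_lt).
  assert (Hcol : forall k, exists b, is_series (fun i => a i k) b).
  { intros k. apply ex_series_C_dominated with (fun i => / r ^ k * M i)%R.
    - intros i. apply (Rmult_le_reg_r (r ^ k)); [apply Hrk|].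
      replace (/ r ^ k * M i * r ^ k)%R with (M i)
        by (field; apply Rgt_not_eq, Hrk).
      destruct (Ha i) as [Hi _]. eapply Rle_trans; [|apply (Hi k)].
      assert (H := sum_f_R0_shift_le (fun k => Cmod (a i k) * r ^ k)%R k 0
        (fun k => wiener_term_nonneg (a i) r k (Rlt_le _ _ Hr))).
      simpl in H. rewrite Nat.add_0_r in H. exact H.
    - exact (ex_series_scal_l (K := R_AbsRing) (/ r ^ k)%R M HM). }
  destruct (functional_choice _ Hcol) as [b Hb]. clear Hcol.
  assert (HF : forall w, (Cmod w <= r)%R ->
    is_series (fun k => b k * w ^ k) (g (z0 + w)) /\
    (forall K, (sum_f_R0 (fun k => Cmod (b k * w ^ k)) K <= Series M)%R)).
  { intros w Hw.
    destruct (fubini_series (fun i k => a i k * w ^ k) (fun i => f i (z0 + w))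
                (fun k => b k * w ^ k) M) as [L [HL [HbL Hbound]]].
    - intros i K. destruct (Ha i) as [Hi _].
      eapply Rle_trans; [|apply (Hi K)]. apply sum_Rle. intros k _.
      rewrite Cmod_mult, Cmod_pow.
      apply Rmult_le_compat_l; [apply Cmod_ge_0|].
      apply pow_incr. split; [apply Cmod_ge_0|exact Hw].
    - exact HM.
    - intros i. now apply (Ha i).
    - intros k. rewrite Cmult_comm.
      apply is_series_C_ext with (2 := is_series_C_scal (w ^ k) _ _ (Hb k)).
      intros i. ring.
    - split; [|exact Hbound].
      replace (g (z0 + w)) with L; [exact HbL|].
      apply (is_series_C_unique _ _ _ HL). apply Hg.
      now replace (z0 + w - z0) with w by ring. }
  exists b. split.
  - intros K. destruct (HF (RtoC r)) as [_ H].
    { rewrite Cmod_R, Rabs_pos_eq; lra. }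
    eapply Rle_trans; [|apply (H K)]. apply Req_le, sum_eq. intros k _.
    rewrite Cmod_mult, Cmod_pow, Cmod_R, Rabs_pos_eq by lra. reflexivity.
  - intros w Hw. apply (HF w Hw).
Qed.

Lemma wiener_le (f : C -> C) (z0 : C) (r M N : R) :
  (M <= N)%R -> wiener f z0 r M -> wiener f z0 r N.
Proof.
  intros H [a [Ha Hf]]. exists a. split; [|exact Hf].
  intros K. specialize (Ha K). lra.
Qed.

Lemma wiener_nonneg (f : C -> C) (z0 : C) (r M : R) :
  (0 <= r)%R -> wiener f z0 r M -> (0 <= M)%R.
Proof.
  intros Hr Hf.
  eapply Rle_trans; [|apply (wiener_bound f z0 r M 0 Hf)].
  - apply Cmod_ge_0.
  - now rewrite Cmod_0.
Qed.

Lemma wiener_at_ext (f g : C -> C) (z0 : C) :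
  (forall z, f z = g z) -> wiener_at f z0 -> wiener_at g z0.
Proof.
  intros E (r & M & Hr & Hf). exists r, M. split; [exact Hr|].
  now apply wiener_ext with f.
Qed.

Lemma wiener_at_const (c z0 : C) : wiener_at (fun _ => c) z0.
Proof. exists 1%R, (Cmod c). split; [lra|apply wiener_const]. Qed.

Lemma wiener_at_plus (f g : C -> C) (z0 : C) :
  wiener_at f z0 -> wiener_at g z0 -> wiener_at (fun z => f z + g z) z0.
Proof.
  intros (r & M & Hr & Hf) (r' & N & Hr' & Hg).
  assert (H : (0 < Rmin r r')%R) by now apply Rmin_pos.
  assert (H1 := Rmin_l r r'). assert (H2 := Rmin_r r r').
  exists (Rmin r r'), (M + N)%R. split; [exact H|].
  apply wiener_plus; [lra| |].
  - apply wiener_shrink with r; [lra|exact Hf].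
  - apply wiener_shrink with r'; [lra|exact Hg].
Qed.

Lemma wiener_at_scal (c : C) (f : C -> C) (z0 : C) :
  wiener_at f z0 -> wiener_at (fun z => c * f z) z0.
Proof.
  intros (r & M & Hr & Hf). exists r, (Cmod c * M)%R.
  split; [exact Hr|now apply wiener_scal].
Qed.

Lemma wiener_at_mul_affine (c : C) (f : C -> C) (z0 : C) :
  wiener_at f z0 -> wiener_at (fun z => (z + c) * f z) z0.
Proof.
  intros (r & M & Hr & Hf). exists r, ((Cmod (z0 + c)%C + r) * M)%R.
  split; [exact Hr|]. apply wiener_mul_affine; [lra|exact Hf].
Qed.

Lemma wiener_at_shift (c : C) (f : C -> C) (z0 : C) :
  wiener_at f (z0 + c) -> wiener_at (fun z => f (z + c)) z0.
Proof.
  intros (r & M & Hr & Hf). exists r, M.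
  split; [exact Hr|now apply wiener_shift].
Qed.

Lemma wiener_at_sum_n (f : nat -> C -> C) (z0 : C) (n : nat) :
  (forall j, wiener_at (f j) z0) ->
  wiener_at (fun z => sum_n (fun j => f j z) n) z0.
Proof.
  intros Hf. induction n as [|n IH].
  - apply wiener_at_ext with (f 0%nat); [|apply Hf].
    intros z. now rewrite sum_O.
  - apply wiener_at_ext with (fun z => sum_n (fun j => f j z) n + f (S n) z).
    + intros z. now rewrite Csum_Sn.
    + now apply wiener_at_plus.
Qed.

(** Moving the exponent by at most [r] costs at most a factor [x ^ r]. *)
Lemma wiener_Rcpow (x r : R) (z0 : C) :
  (1 <= x)%R -> (0 <= r)%R ->
  wiener (fun z => Rcpow x (- z)) z0 r (Rpower x (r - Re z0)).
Proof.
  intros Hx Hr. assert (Hl := ln_ge_0 x Hx).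
  exists (fun k => Rcpow x (- z0) * ((- RtoC (ln x)) ^ k / INR (fact k))).
  split.
  - intros K.
    assert (E : Rpower x (r - Re z0) = (Cmod (Rcpow x (- z0)) *
                   exp (ln x * r))%R).
    { unfold Rcpow, Rpower. rewrite Cmod_Cexp, <- exp_plus. f_equal.
      simpl. unfold Re, Im; simpl. ring. }
    rewrite E.
    eapply Rle_trans; [|apply Rmult_le_compat_l; [apply Cmod_ge_0|
      apply (exp_partial_le (ln x * r) K); nra]].
    rewrite scal_sum. apply sum_Rle. intros k _.
    rewrite Cmod_mult, Cmod_exp_term, Cmod_opp, Cmod_R, Rabs_pos_eq by lra.
    rewrite Rpow_mult_distr. apply Req_le. field. apply INR_fact_neq_0.
  - intros w _.
    replace (Rcpow x (- (z0 + w)))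
      with (Rcpow x (- z0) * Cexp (- RtoC (ln x) * w)).
    2:{ unfold Rcpow. rewrite <- Cexp_plus. f_equal. ring. }
    apply is_series_C_ext with
      (2 := is_series_C_scal _ _ _ (Cexp_series (- RtoC (ln x) * w))).
    intros k. rewrite Cpow_mult_l. unfold Cdiv. ring.
Qed.

(** * Isolated zeros and continuation *)

Definition zero_near (f : C -> C) (z : C) : Prop :=
  exists r : R, (0 < r)%R /\ forall w, (Cmod w <= r)%R -> f (z + w) = 0.

(** If the first nonzero coefficient were [a n], every small zero [w] would
    give [|a n| <= |w| M / r ^ (n + 1)]. *)
Lemma isolated_zeros (f : C -> C) (z0 : C) :
  wiener_at f z0 ->
  (forall eps, (0 < eps)%R ->
     exists w : C, w <> 0 /\ (Cmod w < eps)%R /\ f (z0 + w) = 0) ->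
  zero_near f z0.
Proof.
  intros (r & M & Hr & a & Ha & Hf) HZ.
  assert (Hall : forall n, a n = 0).
  { intros n. induction n as [n IH] using Wf_nat.lt_wf_ind.
    apply NNPP. intros Hn. apply Cmod_gt_0 in Hn.
    assert (Hrn : (0 < r ^ S n)%R) by now apply pow_lt.
    assert (HM : (0 <= M)%R).
    { eapply Rle_trans; [|apply (Ha 0%nat)].
      apply (wiener_term_nonneg a r 0). lra. }
    destruct (HZ (Rmin r (Cmod (a n) * r ^ S n / (M + 1)))%R)
      as (w & Hw0 & Hw & Hfw).
    { apply Rmin_pos; [exact Hr|]. apply Rdiv_lt_0_compat; [nra|lra]. }
    apply (proj1 (Cmod_gt_0 w)) in Hw0.
    assert (Hw1 : (Cmod w < r)%R)
      by (eapply Rlt_le_trans; [exact Hw|apply Rmin_l]).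
    assert (Hw2 : (Cmod w < Cmod (a n) * r ^ S n / (M + 1))%R)
      by (eapply Rlt_le_trans; [exact Hw|apply Rmin_r]).
    assert (Hs : forall m, (m <= n)%nat ->
       is_series (fun k => a (m + k)%nat * w ^ (m + k)) (RtoC 0)).
    { induction m as [|m IHm]; intros Hm.
      - simpl. rewrite <- Hfw. apply Hf. lra.
      - assert (H := IHm ltac:(lia)).
        apply (is_series_C_ext (fun k => a (m + S k)%nat * w ^ (m + S k))).
        { intros k. now rewrite Nat.add_succ_r. }
        apply (is_series_C_cons (fun k => a (m + k)%nat * w ^ (m + k))).
        rewrite Nat.add_0_r, (IH m) by lia.
        replace (0 * w ^ m + 0) with (RtoC 0) by ring. exact H. }
    assert (H1 : is_series (fun k => a (n + S k)%nat * w ^ (n + S k))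
                   (- (a n * w ^ n))).
    { apply (is_series_C_cons (fun k => a (n + k)%nat * w ^ (n + k))).
      rewrite Nat.add_0_r.
      replace (a n * w ^ n + - (a n * w ^ n)) with (RtoC 0) by ring.
      apply Hs. lia. }
    set (q := (Cmod w ^ S n / r ^ S n)%R).
    assert (Hq : (0 <= q)%R).
    { apply Rmult_le_pos; [apply pow_le, Cmod_ge_0|].
      apply Rlt_le, Rinv_0_lt_compat, Hrn. }
    assert (H2 := Cmod_series_le _ _ (q * M)%R H1).
    assert (H3 : (Cmod (a n) * Cmod w ^ n <= q * M)%R).
    { rewrite <- Cmod_pow, <- Cmod_mult, <- Cmod_opp. apply H2. intros K.
      apply Rle_trans with
        (q * sum_f_R0 (fun k => Cmod (a (S n + k)%nat) * r ^ (S n + k)) K)%R.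
      - rewrite scal_sum. apply sum_Rle. intros k _.
        rewrite Cmod_mult, Cmod_pow.
        replace (n + S k)%nat with (S n + k)%nat by lia.
        rewrite Rmult_assoc. apply Rmult_le_compat_l; [apply Cmod_ge_0|].
        rewrite !pow_add. unfold q.
        replace (r ^ S n * r ^ k * (Cmod w ^ S n / r ^ S n))%R
          with (Cmod w ^ S n * r ^ k)%R by (field; lra).
        apply Rmult_le_compat_l; [apply pow_le, Cmod_ge_0|].
        apply pow_incr. split; [apply Cmod_ge_0|lra].
      - apply Rmult_le_compat_l; [exact Hq|].
        eapply Rle_trans; [|apply (Ha (S n + K)%nat)].
        apply (sum_f_R0_shift_le (fun k => Cmod (a k) * r ^ k)%R).
        intros k. apply wiener_term_nonneg. lra. }
    assert (Hwn : (0 < Cmod w ^ n)%R) by now apply pow_lt.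
    assert (H4 : (Cmod (a n) * r ^ S n <= Cmod w * M)%R).
    { apply (Rmult_le_reg_r (Cmod w ^ n)); [exact Hwn|].
      replace (Cmod (a n) * r ^ S n * Cmod w ^ n)%R
        with (Cmod (a n) * Cmod w ^ n * r ^ S n)%R by ring.
      replace (Cmod w * M * Cmod w ^ n)%R with (q * M * r ^ S n)%R.
      - apply Rmult_le_compat_r; lra.
      - unfold q. simpl pow at 1. field. lra. }
    assert (H5 : (Cmod w * (M + 1) < Cmod (a n) * r ^ S n)%R).
    { apply (Rmult_lt_compat_r (M + 1)) in Hw2; [|lra].
      replace (Cmod (a n) * r ^ S n / (M + 1) * (M + 1))%R
        with (Cmod (a n) * r ^ S n)%R in Hw2 by (field; lra).
      exact Hw2. }
    nra. }
  exists r. split; [exact Hr|]. intros w Hw.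
  apply (is_series_C_unique _ _ _ (Hf w Hw)).
  apply is_series_C_zero. intros n. rewrite Hall. apply Cmult_0_l.
Qed.

(** The parameters up to which [f] vanishes near the segment form a set that
    is closed by [isolated_zeros] and open by definition. *)
Lemma continuation_segment (f : C -> C) (p d : C) :
  (forall t : R, (0 <= t <= 1)%R -> wiener_at f (p + t * d)) ->
  zero_near f p -> zero_near f (p + d).
Proof.
  intros Hf Hp.
  destruct (classic (d = 0)) as [->|Hd].
  { now replace (p + 0) with p by ring. }
  apply Cmod_gt_0 in Hd.
  set (E := fun t : R => (0 <= t <= 1)%R /\
              forall u : R, (0 <= u <= t)%R -> zero_near f (p + u * d)).
  assert (E0 : E 0%R).
  { split; [lra|]. intros u Hu. replace u with 0%R by lra.
    now replace (p + 0 * d) with p by ring. }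
  destruct (completeness E) as [T [HT1 HT2]].
  { exists 1%R. intros t [Ht _]. lra. }
  { now exists 0%R. }
  assert (HT01 : (0 <= T <= 1)%R).
  { split; [now apply HT1|]. apply HT2. intros t [Ht _]. lra. }
  assert (Hnear : forall e, (0 < e)%R -> exists t, E t /\ (T - e < t)%R).
  { intros e He. apply NNPP. intros Hn.
    assert (H : is_upper_bound E (T - e)).
    { intros t Ht. apply Rnot_lt_le. intros Hlt. apply Hn. now exists t. }
    specialize (HT2 _ H). lra. }
  assert (HzT : zero_near f (p + T * d)).
  { destruct (classic (E T)) as [[_ HET]|HnE].
    - apply HET. lra.
    - apply isolated_zeros; [now apply Hf|].
      intros eps He.
      destruct (Hnear (eps / Cmod d)%R) as [t [Et Ht]].
      { now apply Rdiv_lt_0_compat. }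
      assert (HtT : (t < T)%R).
      { destruct (Rle_lt_or_eq_dec t T) as [H|H]; [now apply HT1|exact H|].
        now subst t. }
      exists ((t - T)%R * d). repeat split.
      + apply Cmod_gt_0. rewrite Cmod_mult, Cmod_R.
        apply Rmult_lt_0_compat; [|exact Hd]. apply Rabs_pos_lt. lra.
      + rewrite Cmod_mult, Cmod_R, Rabs_left by lra.
        apply (Rmult_lt_reg_r (/ Cmod d)); [now apply Rinv_0_lt_compat|].
        replace (- (t - T) * Cmod d * / Cmod d)%R with (T - t)%R
          by (field; lra).
        unfold Rdiv in Ht. lra.
      + replace (p + T * d + (t - T)%R * d) with (p + t * d)
          by (rewrite RtoC_minus; ring).
        destruct Et as [Ht01 Et].
        destruct (Et t) as [r [Hr Hz]]; [lra|].
        rewrite <- (Hz 0); [f_equal; ring|]. rewrite Cmod_0. lra. }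
  assert (HET : forall u : R, (0 <= u <= T)%R -> zero_near f (p + u * d)).
  { intros u Hu. destruct (Req_dec u T) as [->|Hne]; [exact HzT|].
    destruct (Hnear (T - u)%R) as [t [[_ Et] Ht]]; [lra|].
    apply Et. lra. }
  destruct (Req_dec T 1) as [->|HT].
  { now replace (p + d) with (p + 1 * d) by ring. }
  exfalso. destruct HzT as [r [Hr Hz]].
  set (T' := Rmin 1 (T + r / (2 * Cmod d))%R).
  assert (Hpos : (0 < r / (2 * Cmod d))%R) by (apply Rdiv_lt_0_compat; lra).
  assert (HT' : (T < T')%R) by (apply Rmin_glb_lt; lra).
  assert (HT'1 : (T' <= 1)%R) by apply Rmin_l.
  assert (HT'2 : (T' <= T + r / (2 * Cmod d))%R) by apply Rmin_r.
  assert (HE' : E T').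
  { split; [lra|]. intros u Hu.
    destruct (Rle_lt_dec u T) as [H|H]; [now apply HET|].
    exists (r / 2)%R. split; [lra|]. intros w Hw.
    replace (p + u * d + w) with (p + T * d + ((u - T)%R * d + w))
      by (rewrite RtoC_minus; ring).
    apply Hz. eapply Rle_trans; [apply Cmod_triangle|].
    rewrite Cmod_mult, Cmod_R, Rabs_pos_eq by lra.
    assert (H1 : ((u - T) * Cmod d <= r / (2 * Cmod d) * Cmod d)%R)
      by (apply Rmult_le_compat_r; lra).
    replace (r / (2 * Cmod d) * Cmod d)%R with (r / 2)%R in H1
      by (field; lra).
    lra. }
  specialize (HT1 _ HE'). lra.
Qed.

(** On the disc of radius [r], [|w| ^ k <= (|w| / r) r ^ k] for [k >= 1]. *)
Lemma wiener_lipschitz (f : C -> C) (z0 : C) (r M : R) (w : C) :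
  (0 < r)%R -> wiener f z0 r M -> (Cmod w <= r)%R ->
  (Cmod (f (z0 + w)%C - f z0) <= Cmod w / r * M)%R.
Proof.
  intros Hr [a [Ha Hf]] Hw.
  assert (H0 : is_series (fun k => a k * 0 ^ k) (f z0)).
  { replace (f z0) with (f (z0 + 0)) by (f_equal; ring).
    apply Hf. rewrite Cmod_0. lra. }
  apply Cmod_series_le with (1 := is_series_C_minus _ _ _ _ (Hf w Hw) H0).
  assert (Hw0 := Cmod_ge_0 w).
  assert (Hq : (0 <= Cmod w / r)%R)
    by (apply Rmult_le_pos; [lra|apply Rlt_le, Rinv_0_lt_compat, Hr]).
  intros K. eapply Rle_trans;
    [|apply Rmult_le_compat_l; [exact Hq|apply (Ha K)]].
  rewrite scal_sum. apply sum_Rle. intros k _.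
  replace (a k * w ^ k - a k * 0 ^ k) with (a k * (w ^ k - 0 ^ k)) by ring.
  rewrite Cmod_mult, Rmult_assoc.
  apply Rmult_le_compat_l; [apply Cmod_ge_0|].
  destruct k as [|k].
  - simpl. replace (1 - 1) with (RtoC 0) by ring. rewrite Cmod_0. lra.
  - replace (w ^ S k - 0 ^ S k) with (w * w ^ k) by (simpl; ring).
    rewrite Cmod_mult, Cmod_pow. simpl.
    replace (r * r ^ k * (Cmod w / r))%R with (Cmod w * r ^ k)%R
      by (field; lra).
    apply Rmult_le_compat_l; [lra|]. apply pow_incr. lra.
Qed.

Lemma wiener_at_continuous (f : C -> C) (z0 : C) :
  wiener_at f z0 -> filterlim f (locally z0) (locally (f z0)).
Proof.
  intros (r & M & Hr & HW).
  apply (filterlim_locally_ball_norm (K := C_AbsRing) (U := C_NormedModule)).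
  intros eps.
  assert (He := cond_pos eps).
  assert (HM : (0 <= M)%R).
  { eapply Rle_trans; [|apply (wiener_bound f z0 r M 0 HW)].
    - apply Cmod_ge_0.
    - rewrite Cmod_0. lra. }
  set (delta := Rmin r (eps * r / (M + 1)) : R).
  assert (Hd : (0 < delta)%R).
  { apply Rmin_pos; [exact Hr|]. apply Rdiv_lt_0_compat; [nra|lra]. }
  assert (Hd2 : (0 < delta / 2)%R) by lra.
  exists (mkposreal _ Hd2). intros z Hz.
  apply C_NormedModule_mixin_compat2 in Hz. simpl pos in Hz.
  change (minus z z0) with (z - z0) in Hz.
  assert (Hs2 : (sqrt 2 <= 2)%R).
  { rewrite <- (sqrt_pow2 2) at 2 by lra. apply sqrt_le_1_alt. simpl. lra. }
  set (w := z - z0) in *.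
  assert (Hw : (Cmod w < delta)%R) by nra.
  assert (Hwr : (Cmod w <= r)%R).
  { apply Rlt_le, Rlt_le_trans with (1 := Hw), Rmin_l. }
  assert (Hwe : (Cmod w < eps * r / (M + 1))%R).
  { apply Rlt_le_trans with (1 := Hw), Rmin_r. }
  change (Cmod (f z - f z0) < eps)%R.
  replace z with (z0 + w) by (unfold w; ring).
  apply Rle_lt_trans with (1 := wiener_lipschitz f z0 r M w Hr HW Hwr).
  apply (Rmult_lt_compat_r ((M + 1) / r)) in Hwe;
    [|apply Rdiv_lt_0_compat; lra].
  replace (eps * r / (M + 1) * ((M + 1) / r))%R with (pos eps) in Hwe
    by (field; lra).
  apply Rle_lt_trans with (2 := Hwe).
  assert (Hw0 := Cmod_ge_0 w). assert (0 < / r)%R by now apply Rinv_0_lt_compat.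
  unfold Rdiv. nra.
Qed.

(** * Analyticity of the terms and of their sum *)

Fixpoint Crising (z : C) (n : nat) : C :=
  match n with
  | O => 1
  | S m => Crising z m * (z + INR m)
  end.

Lemma Crising_RtoC (a : R) n : Crising (RtoC a) n = RtoC (rising a n).
Proof.
  induction n as [|n IH]; simpl; [reflexivity|].
  now rewrite IH, RtoC_mult, RtoC_plus.
Qed.

(** Removing the first factor of a falling factorial, not the last one, is what
    turns it into a rising factorial. *)
Lemma falling_S (z : C) n : falling (z + 1) (S n) = (z + 1) * falling z n.
Proof.
  induction n as [|n IH].
  - simpl. ring.
  - change (falling (z + 1) (S (S n))) with
      (falling (z + 1) (S n) * (z + 1 - INR (S n))).
    rewrite IH. change (falling z (S n)) with (falling z n * (z - INR n)).
    rewrite S_INR, RtoC_plus. ring.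
Qed.

Lemma falling_rising (z : C) n : falling (z + INR n - 1) n = Crising z n.
Proof.
  induction n as [|n IH]; [reflexivity|].
  replace (z + INR (S n) - 1) with ((z + INR n - 1) + 1)
    by (rewrite S_INR, RtoC_plus; ring).
  rewrite falling_S, IH. simpl Crising. ring.
Qed.

(** The norm of the factor [z - 1 + m] is at most [|z0 - 1| + r + m], so a
    rising factorial of functions is dominated by a real one. *)
Lemma wiener_mul_rising (f : C -> C) (z0 : C) (r M : R) n :
  (0 < r)%R -> wiener f z0 r M ->
  wiener (fun z => Crising (z - 1) n * f z) z0 r
    (rising (Cmod (z0 - 1) + r) n * M).
Proof.
  intros Hr Hf. assert (HM := wiener_nonneg f z0 r M (Rlt_le _ _ Hr) Hf).
  assert (Hp : (0 < Cmod (z0 - 1) + r)%R)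
    by (assert (H := Cmod_ge_0 (z0 - 1)); lra).
  induction n as [|n IH].
  - simpl. rewrite Rmult_1_l. apply wiener_ext with f; [|exact Hf].
    intros z. ring.
  - apply wiener_ext with
      (fun z => (z + (INR n - 1)) * (Crising (z - 1) n * f z)).
    { intros z. simpl. ring. }
    eapply wiener_le; [|apply wiener_mul_affine; [lra|exact IH]].
    set (A := (Cmod (z0 - 1) + r)%R) in *.
    replace (rising A (S n) * M)%R with ((A + INR n) * (rising A n * M))%R
      by (simpl; ring).
    apply Rmult_le_compat_r.
    + apply Rmult_le_pos; [|exact HM]. now apply Rlt_le, rising_pos.
    + assert (H := Cmod_triangle (z0 - 1) (INR n)).
      replace (z0 - 1 + INR n) with (z0 + (INR n - 1)) in H by ring.
      rewrite Cmod_R, Rabs_pos_eq in H by apply pos_INR. unfold A. lra.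
Qed.

Lemma wiener_at_mul_rising (f : C -> C) (z0 : C) n :
  wiener_at f z0 -> wiener_at (fun z => Crising (z - 1) n * f z) z0.
Proof.
  intros (r & M & Hr & Hf).
  exists r, (rising (Cmod (z0 - 1) + r) n * M)%R.
  split; [exact Hr|now apply wiener_mul_rising].
Qed.

(** The summable and telescoping majorant [1 / ((n + 1) (n + 2))] of
    [1 / (n + 2) ^ 2]. *)
Definition tail_weight (n : nat) : R := (/ INR (S n) - / INR (S (S n)))%R.

Lemma tail_weight_sum K : (sum_f_R0 tail_weight K <= 1)%R.
Proof.
  assert (H : sum_f_R0 tail_weight K = (1 - / INR (S (S K)))%R).
  { induction K as [|K IH].
    - unfold tail_weight. simpl. field.
    - rewrite tech5, IH. unfold tail_weight. ring. }
  rewrite H. assert (0 < / INR (S (S K)))%R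
    by (apply Rinv_0_lt_compat, lt_0_INR; lia). lra.
Qed.

Lemma tail_weight_pos n : (0 <= tail_weight n)%R.
Proof.
  unfold tail_weight. rewrite (S_INR (S n)).
  assert (H : (0 < INR (S n))%R) by (apply lt_0_INR; lia).
  assert (H1 : (/ (INR (S n) + 1) <= / INR (S n))%R)
    by (apply Rinv_le_contravar; lra).
  lra.
Qed.

(** Two units of the exponent make the sum over [n] converge; each of the
    others gains a factor [1 / 2], as the base is at least [2]. *)
Lemma Rpower_tail_le (e : R) (j n : nat) :
  (2 + INR j <= e)%R ->
  (Rpower (INR (S (S n))) (- e) <= (/ 2) ^ j * tail_weight n)%R.
Proof.
  intros He. set (N := INR (S (S n))).
  assert (Hn := pos_INR n).
  assert (HN : (2 <= N)%R) by (unfold N; rewrite !S_INR; lra).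
  apply Rle_trans with (Rpower N (- (2 + INR j))).
  { apply Rle_Rpower; lra. }
  rewrite Rpower_Ropp, Rpower_plus.
  rewrite Rpower_pow by lra.
  replace (Rpower N 2) with (N * N)%R.
  2:{ replace 2%R with (INR 2) by (simpl; ring).
      rewrite Rpower_pow by lra. ring. }
  rewrite Rinv_mult, Rmult_comm, <- pow_inv.
  assert (Hi : (0 < / N)%R) by (apply Rinv_0_lt_compat; lra).
  apply Rmult_le_compat.
  - apply pow_le. lra.
  - apply Rlt_le, Rinv_0_lt_compat. nra.
  - apply pow_incr. split; [lra|]. apply Rinv_le_contravar; lra.
  - unfold tail_weight. fold N.
    replace (INR (S n)) with (N - 1)%R by (unfold N; rewrite (S_INR (S n)); ring).
    replace (/ (N - 1) - / N)%R with (/ (N * (N - 1)))%R by (field; lra).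
    apply Rinv_le_contravar; nra.
Qed.

Section Zeta.

Variable zeta : C -> C.
Hypothesis Hzeta : is_riemann_zeta zeta.

Lemma zeta_tail_series (s : C) : (1 < Re s)%R ->
  is_series (fun n => Rcpow (INR (S (S n))) (- s)) (zeta s - 1).
Proof.
  intros Hs. destruct Hzeta as [HD _].
  apply (is_series_C_cons (fun n => Rcpow (INR (S n)) (- s))).
  replace (Rcpow (INR 1) (- s) + (zeta s - 1)) with (zeta s); [now apply HD|].
  replace (Rcpow (INR 1) (- s)) with (RtoC 1); [ring|].
  unfold Rcpow. simpl INR. rewrite ln_1.
  replace (- s * 0) with (RtoC 0) by ring.
  unfold Cexp. simpl. rewrite exp_0, cos_0, sin_0. ring.
Qed.

Lemma zeta_tail_wiener (z0 : C) (r : R) (i j : nat) :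
  (0 < r)%R -> (2 + INR j <= Re z0 + INR i - r)%R ->
  wiener (fun z => zeta (z + INR i) - 1) z0 r ((/ 2) ^ j).
Proof.
  intros Hr Hij.
  set (M := fun n => ((/ 2) ^ j * tail_weight n)%R).
  assert (Hh : (0 < (/ 2) ^ j)%R) by (apply pow_lt; lra).
  assert (HM : ex_series M /\ (Series M <= (/ 2) ^ j)%R).
  { apply ex_series_bounded.
    - intros n. apply Rmult_le_pos; [lra|apply tail_weight_pos].
    - intros K. unfold M.
      rewrite (sum_eq _ (fun n => tail_weight n * (/ 2) ^ j)%R)
        by (intros; ring).
      rewrite <- scal_sum. assert (H := tail_weight_sum K). nra. }
  destruct HM as [HM1 HM2].
  apply wiener_le with (1 := HM2).
  apply wiener_series with (fun n z => Rcpow (INR (S (S n))) (- (z + INR i)));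
    [exact Hr| |exact HM1|].
  - intros n.
    apply wiener_shift with (f := fun z => Rcpow (INR (S (S n))) (- z)).
    eapply wiener_le; [|apply wiener_Rcpow; [|lra]].
    + replace (r - Re (z0 + INR i))%R with (- (Re z0 + INR i - r))%R
        by (unfold Re; simpl; ring).
      now apply Rpower_tail_le.
    + rewrite !S_INR. assert (H := pos_INR n). lra.
  - intros z Hz. apply zeta_tail_series.
    assert (H1 := re_le_Cmod (z - z0)).
    assert (H2 := Rabs_maj2 (Re (z - z0))).
    simpl in *. assert (H3 := pos_INR j). unfold Re in *. lra.
Qed.

Variable d : nat.

Let T (j : nat) (z : C) : C := series_term zeta (S d) z (S d + j).

Lemma series_term_rising (j : nat) (z : C) :
  T j z = RtoC (bernoulli_sum d (S (S d) + j) / INR (fact (S (S d) + j))) *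
          (Crising (z - 1) (S (S d) + j) * (zeta (z + INR (S d + j)) - 1)).
Proof.
  unfold T, series_term, Cbinom. rewrite Nat.add_1_r.
  replace (z + INR (S d + j) - 1) with ((z - 1) + INR (S (S d + j)) - 1)
    by (rewrite (S_INR (S d + j)), RtoC_plus; ring).
  rewrite falling_rising.
  replace (S d - 1)%nat with d by lia.
  replace (sum_n _ d) with (RtoC (bernoulli_sum d (S (S d) + j))).
  - rewrite RtoC_div by apply INR_fact_neq_0. 
    change (S (S d) + j)%nat with (S (S d + j)).
    unfold Cdiv. ring.
  - rewrite RtoC_sum_n, sum_n_Reals. f_equal. apply sum_eq. intros k Hk.
    rewrite binom_le by lia. reflexivity.
Qed.

(** Convergence of [binomial_column] at [N = 2] makes the geometric decay of
    [zeta (z + i) - 1] absorb the growth of the other factors. *)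
Definition majorant (a : R) (j : nat) : R :=
  ((/ 2) ^ j * (rising_coef a j *
     sum_f_R0 (fun k => binom j k * Rabs (bernoulli k)) d))%R.

Lemma binom_nonneg j k : (0 <= binom j k)%R.
Proof.
  unfold binom. destruct (k <=? j)%nat; [|lra].
  unfold Binomial.C. apply Rlt_le, Rdiv_lt_0_compat; [apply INR_fact_lt_0|].
  apply Rmult_lt_0_compat; apply INR_fact_lt_0.
Qed.

Lemma bernoulli_sum_abs j :
  (Rabs (bernoulli_sum d j) <=
   sum_f_R0 (fun k => binom j k * Rabs (bernoulli k)) d)%R.
Proof.
  eapply Rle_trans; [apply Rsum_abs|]. apply sum_Rle. intros k _.
  rewrite Rabs_mult, (Rabs_pos_eq (binom j k)) by apply binom_nonneg. lra.
Qed.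

Lemma majorant_summable (a c : R) (m : nat) : (0 < a)%R ->
  ex_series (fun j => c * majorant a (m + j))%R.
Proof.
  intros Ha.
  apply (ex_series_scal_l (K := R_AbsRing) c (fun j => majorant a (m + j))).
  apply (ex_series_incr_n (majorant a)).
  eexists. apply is_series_ext with
    (2 := is_series_sum_f_R0 _ _ d (fun k =>
      is_series_scal_l (Rabs (bernoulli k) * Rpower 2 a)%R _ _
        (binomial_column a 2 k Ha ltac:(lra)))).
  intros j. unfold majorant. rewrite <- Rmult_assoc, scal_sum.
  apply sum_eq. intros k _. unfold scal; simpl; unfold mult; simpl.
  rewrite Ropp_plus_distr, Rpower_plus, !Rpower_Ropp, Rpower_pow, pow_inv by lra.
  field. split; [apply pow_nonzero; lra|apply Rgt_not_eq, exp_pos].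
Qed.

(** Near every [z0], all but finitely many terms have summable norms on one and
    the same disc. *)
Lemma terms_wiener (z0 : C) :
  exists (m : nat) (M : nat -> R), ex_series M /\
    forall j, wiener (T (S m + j)) z0 1 (M j).
Proof.
  (* From index [m] on, [z + i] stays in the half-plane [Re > 2] on the unit
     disc around [z0]. *)
  destruct (INR_unbounded (3 - Re z0)) as [m Hm].
  set (R0 := (Cmod (z0 - 1) + 1)%R).
  assert (HR0 : (0 < R0)%R)
    by (assert (H := Cmod_ge_0 (z0 - 1)); unfold R0; lra).
  set (p := (S (S d) + S m)%nat).
  (* The decay [(1 / 2) ^ j] starts at index [p], whence the factor [2 ^ p]. *)
  exists m, (fun j => 2 ^ p * majorant R0 (p + j))%R.
  split; [now apply majorant_summable|].
  intros j.
  apply wiener_ext with (fun z =>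
    RtoC (bernoulli_sum d (p + j) / INR (fact (p + j))) *
    (Crising (z - 1) (p + j) * (zeta (z + INR (S d + (S m + j))) - 1))).
  { intros z. rewrite series_term_rising. unfold p.
    now rewrite <- !Nat.add_assoc. }
  eapply wiener_le; [|apply wiener_scal, wiener_mul_rising;
    [lra|apply (zeta_tail_wiener z0 1 _ j); [lra|]]].
  - fold R0. unfold majorant, rising_coef.
    assert (Hf := INR_fact_lt_0 (p + j)).
    assert (Hr := rising_pos R0 (p + j) HR0).
    assert (Hh : (0 < (/ 2) ^ j)%R) by (apply pow_lt; lra).
    rewrite Cmod_R, Rabs_div, (Rabs_pos_eq (INR _)) by lra.
    assert (Hb := bernoulli_sum_abs (p + j)).
    set (S0 := sum_f_R0 _ d) in *.
    rewrite pow_add.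
    replace (2 ^ p * ((/ 2) ^ p * (/ 2) ^ j *
               (rising R0 (p + j) / INR (fact (p + j)) * S0)))%R
      with (S0 * (/ INR (fact (p + j)) * (rising R0 (p + j) * (/ 2) ^ j)))%R.
    2:{ rewrite !pow_inv. field. repeat split; try apply pow_nonzero; lra. }
    unfold Rdiv. rewrite Rmult_assoc.
    apply Rmult_le_compat_r; [|exact Hb].
    apply Rmult_le_pos; [apply Rlt_le, Rinv_0_lt_compat, Hf|].
    apply Rmult_le_pos; lra.
  - rewrite !plus_INR, !S_INR. assert (H := pos_INR d). lra.
Qed.

Definition term_sum (z : C) : C :=
  @iota (CompleteNormedModule.CompleteSpace _ C_CompleteNormedModule)
    (fun l : C => is_series (fun j => T j z) l).

Lemma term_sum_correct (z : C) : is_series (fun j => T j z) (term_sum z).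
Proof.
  assert (H : exists l, is_series (fun j => T j z) l).
  { destruct (terms_wiener z) as (m & M & HM & HW).
    destruct (ex_series_C_dominated (fun j => T (S m + j) z) M) as [l Hl].
    - intros j. rewrite <- (Cplus_0_r z).
      apply wiener_bound with (1 := HW j). rewrite Cmod_0. lra.
    - exact HM.
    - exists (sum_n (fun j => T j z) m + l).
      exact (proj1 (is_series_C_drop (fun j => T j z) m l) Hl). }
  destruct H as [l Hl]. unfold term_sum.
  apply (iota_correct (V := C_CompleteNormedModule)
           (fun l : C => is_series (fun j => T j z) l)).
  exists l. split; [exact Hl|]. intros l' Hl'.
  exact (is_series_C_unique _ _ _ Hl Hl').
Qed.

Lemma zeta_wiener_at (s : C) : s <> 1 -> wiener_at zeta s.
Proof. intros Hs. apply analytic_at_wiener. now apply Hzeta. Qed.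

Lemma term_wiener_at (z0 : C) (j : nat) :
  terms_defined (S d) z0 -> wiener_at (T j) z0.
Proof.
  intros [_ HD].
  eapply wiener_at_ext; [intros z; symmetry; apply series_term_rising|].
  apply wiener_at_scal, wiener_at_mul_rising.
  apply wiener_at_plus; [|apply wiener_at_const].
  apply wiener_at_shift. apply zeta_wiener_at, HD. lia.
Qed.

Lemma term_sum_wiener_at (z0 : C) :
  terms_defined (S d) z0 -> wiener_at term_sum z0.
Proof.
  intros HD.
  destruct (terms_wiener z0) as (m & M & HM & HW).
  apply wiener_at_ext with (fun z => sum_n (fun j => T j z) m +
    (term_sum z - sum_n (fun j => T j z) m)).
  { intros z. now rewrite Cplus_comm, Cminus_plus. }
  apply wiener_at_plus.
  - apply wiener_at_sum_n. intros j. now apply term_wiener_at.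
  - exists 1%R, (Series M). split; [lra|].
    apply wiener_series with (fun j => T (S m + j));
      [lra|exact HW|exact HM|].
    intros z _.
    apply (proj2 (is_series_C_drop (fun j => T j z) m
                    (term_sum z - sum_n (fun j => T j z) m))).
    rewrite Cplus_comm, Cminus_plus. apply term_sum_correct.
Qed.

(** * The defect of the identity *)

Definition bernoulli_part (s : C) : C :=
  sum_n (fun k => Cbinom (s + INR k - 2) k * bernoulli k) d.

Lemma bernoulli_part_rising (s : C) :
  bernoulli_part s =
  sum_n (fun k => (bernoulli k / INR (fact k))%R * (Crising (s - 1) k * 1)) d.
Proof.
  apply Csum_ext. intros k. unfold Cbinom.
  replace (s + INR k - 2) with ((s - 1) + INR k - 1) by ring.
  rewrite falling_rising, RtoC_div by apply INR_fact_neq_0.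
  unfold Cdiv. ring.
Qed.

Definition defect (s : C) : C :=
  (s - 1) * (zeta s - 1) - bernoulli_part s + term_sum s.

Lemma defect_wiener_at (z0 : C) :
  terms_defined (S d) z0 -> wiener_at defect z0.
Proof.
  intros HD. unfold defect. apply wiener_at_plus.
  2: now apply term_sum_wiener_at.
  apply wiener_at_plus.
  - apply (wiener_at_mul_affine (- (1))).
    apply wiener_at_plus; [|apply wiener_at_const].
    apply zeta_wiener_at, HD.
  - apply wiener_at_ext with (fun z => - (1) * bernoulli_part z).
    { intros z. ring. }
    apply wiener_at_scal.
    eapply wiener_at_ext; [intros z; symmetry; apply bernoulli_part_rising|].
    apply wiener_at_sum_n. intros k.
    apply wiener_at_scal, (wiener_at_mul_rising (fun _ => 1)), wiener_at_const.
Qed.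

(** Real [s > 1]: expand [zeta (s + i) - 1] into powers of [n >= 2] and sum over
    [i] first; what remains telescopes in [n]. *)
Lemma defect_real (x : R) : (1 < x)%R -> defect x = 0.
Proof.
  intros Hx. set (a := (x - 1)%R). assert (Ha : (0 < a)%R) by (unfold a; lra).
  set (J := fun j => (S (S d) + j)%nat).
  set (e := fun j n => (rising_coef a (J j) * bernoulli_sum d (J j) *
                        Rpower (INR (S (S n))) (- (a + INR (J j))))%R).
  set (col := fun n : nat => (sum_f_R0 (fun k => bernoulli k * rising_coef a k *
       (Rpower (INR (S (S n)) - 1) (- (a + INR k))
        - Rpower (INR (S (S n))) (- (a + INR k)))) d
     - a * Rpower (INR (S (S n))) (- (a + 1)))%R).
  assert (Hpow : forall u n,
     Rcpow (INR (S (S n))) (- RtoC u) = RtoC (Rpower (INR (S (S n))) (- u))).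
  { intros u n. rewrite <- RtoC_opp. apply Rcpow_RtoC. }
  (* As [a + J j >= 2 + (d + j)] and [J j = 2 + (d + j)], the sums over [n] are
     at most [2 ^ 2 * (1 / 2) ^ J j]. *)
  destruct (fubini_series (fun j n => RtoC (e j n)) (fun j => T j x)
    (fun n => RtoC (col n)) (fun j => 2 ^ 2 * majorant a (S (S d) + j))%R)
    as [L [HL [HcL _]]].
  - intros j K.
    apply Rle_trans with (sum_f_R0 (fun n => tail_weight n *
      ((/ 2) ^ (d + j) * (rising_coef a (J j) *
         sum_f_R0 (fun k => binom (J j) k * Rabs (bernoulli k)) d)))%R K).
    + apply sum_Rle. intros n _. unfold e.
      rewrite Cmod_R, !Rabs_mult.
      rewrite (Rabs_pos_eq (rising_coef _ _))
        by now apply Rlt_le, rising_coef_pos.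
      rewrite (Rabs_pos_eq (Rpower _ _)) by apply Rlt_le, exp_pos.
      assert (H1 := bernoulli_sum_abs (J j)).
      assert (H2 := Rpower_tail_le (a + INR (J j)) (d + j) n).
      assert (H3 := rising_coef_pos a (J j) Ha).
      assert (HJ : INR (J j) = (2 + INR (d + j))%R)
        by (unfold J; change (S (S d) + j)%nat with (S (S (d + j)));
            rewrite !S_INR; ring).
      assert (H4 := H2 ltac:(lra)).
      rewrite (Rmult_comm (tail_weight n)), (Rmult_comm ((/ 2) ^ (d + j))).
      rewrite (Rmult_assoc (_ * _)).
      apply Rmult_le_compat.
      * apply Rmult_le_pos; [lra|apply Rabs_pos].
      * apply Rlt_le, exp_pos.
      * apply Rmult_le_compat_l; [lra|exact H1].
      * exact H4.
    + rewrite <- scal_sum.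
      match goal with |- (?u * _ <= _)%R => set (U := u) end.
      assert (HU : (0 <= U)%R).
      { apply Rmult_le_pos; [apply pow_le; lra|].
        apply Rmult_le_pos; [now apply Rlt_le, rising_coef_pos|].
        eapply Rle_trans; [apply Rabs_pos|apply bernoulli_sum_abs]. }
      apply Rle_trans with U.
      * assert (H := tail_weight_sum K). nra.
      * unfold U, majorant, J. simpl pow. simpl Nat.add. lra.
  - now apply majorant_summable.
  - intros j. rewrite series_term_rising.
    assert (E : RtoC x + INR (S d + j) = RtoC (a + INR (J j))).
    { unfold J. change (S (S d) + j)%nat with (S (S d + j)).
      rewrite (S_INR (S d + j)), <- RtoC_plus. f_equal. unfold a. ring. }
    rewrite E. fold (J j).
    replace (RtoC x - 1) with (RtoC a) by (unfold a; now rewrite RtoC_minus).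
    rewrite Crising_RtoC.
    rewrite Cmult_assoc, <- RtoC_mult.
    assert (HRe : (1 < Re (RtoC (a + INR (J j))))%R).
    { change (1 < a + INR (S (S (d + j))))%R. rewrite !S_INR.
      assert (H := pos_INR (d + j)). lra. }
    apply is_series_C_ext with
      (2 := is_series_C_scal _ _ _ (zeta_tail_series _ HRe)).
    intros n. rewrite Hpow, <- RtoC_mult. f_equal. unfold e, rising_coef.
    field. apply INR_fact_neq_0.
  - intros n. apply is_series_RtoC, bernoulli_column; [exact Ha|].
    rewrite !S_INR. assert (H := pos_INR n). lra.
  - assert (ET : term_sum x = L)
      by exact (is_series_C_unique _ _ _ (term_sum_correct x) HL).
    set (P := sum_f_R0 (fun k => bernoulli k * rising_coef a k * 1)%R d).
    assert (EL : L = RtoC P - a * (zeta x - 1)).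
    { apply (is_series_C_unique _ _ _ HcL).
      apply is_series_C_ext with
        (2 := is_series_C_minus _ _ _ _
          (is_series_RtoC _ _ (is_series_sum_f_R0 _ _ d (fun k =>
            is_series_scal_l (bernoulli k * rising_coef a k)%R _ _
              (telescoping_powers (a + INR k)
                 ltac:(assert (H := pos_INR k); lra)))))
          (is_series_C_scal (RtoC a) _ _ (zeta_tail_series (RtoC x) Hx))).
      intros n. rewrite Hpow, <- RtoC_mult, <- RtoC_minus.
      replace (a + 1)%R with x by (unfold a; ring).
      unfold col. replace (a + 1)%R with x by (unfold a; ring). reflexivity. }
    assert (EP : bernoulli_part x = RtoC P).
    { rewrite bernoulli_part_rising. unfold P.
      rewrite <- sum_n_Reals, <- RtoC_sum_n. apply Csum_ext. intros k.
      replace (RtoC x - 1) with (RtoC a) by (unfold a; now rewrite RtoC_minus).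
      rewrite Crising_RtoC, <- !RtoC_mult. f_equal. unfold rising_coef.
      field. apply INR_fact_neq_0. }
    unfold defect. rewrite ET, EL, EP. unfold a. rewrite RtoC_minus. ring.
Qed.

Lemma terms_defined_im (z : C) : Im z <> 0%R -> terms_defined (S d) z.
Proof.
  intros Hz. split.
  - intros ->. now apply Hz.
  - intros i _ E. apply Hz.
    replace (Im z) with (Im (z + INR i)) by (unfold Im; simpl; ring). now rewrite E.
Qed.

Lemma terms_defined_re (z : C) : (1 < Re z)%R -> terms_defined (S d) z.
Proof.
  intros Hz. split.
  - intros ->. simpl in Hz. lra.
  - intros i _ E. assert (H : Re (z + INR i) = 1%R) by now rewrite E.
    simpl in H. assert (H1 := pos_INR i). unfold Re in Hz. lra.
Qed.

(** From [2] one reaches any non-real point vertically, then horizontally,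
    without meeting the excluded points, which are all real. *)
Lemma defect_zero_near (z : C) : Im z <> 0%R -> zero_near defect z.
Proof.
  intros Hz.
  assert (H2 : zero_near defect (RtoC 2)).
  { apply isolated_zeros.
    - apply defect_wiener_at, terms_defined_re. simpl. lra.
    - intros eps He. exists (RtoC (eps / 2)). repeat split.
      + intros E. apply RtoC_inj in E. lra.
      + rewrite Cmod_R, Rabs_pos_eq; lra.
      + rewrite <- RtoC_plus. apply defect_real. lra. }
  set (p := RtoC 2 + (0%R, Im z)).
  assert (H3 : zero_near defect p).
  { apply continuation_segment; [|exact H2].
    intros t _. apply defect_wiener_at, terms_defined_re. simpl. lra. }
  replace z with (p + RtoC (Re z - 2)).
  2:{ apply injective_projections; simpl; unfold Re, Im; ring. }
  apply continuation_segment; [|exact H3].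
  intros t _. apply defect_wiener_at, terms_defined_im.
  simpl. replace (_ + _)%R with (Im z); [exact Hz|]. unfold Im. ring.
Qed.

Lemma defect_zero (z : C) : terms_defined (S d) z -> defect z = 0.
Proof.
  intros HD. assert (H : zero_near defect z).
  { apply isolated_zeros; [now apply defect_wiener_at|].
    intros eps He.
    (* A vertical perturbation that leaves the real axis. *)
    assert (Hw : exists y : R, (y <> 0 /\ Rabs y < eps /\ Im z + y <> 0)%R).
    { destruct (Req_dec (Im z + eps / 2) 0) as [E|E].
      - exists (eps / 3)%R. rewrite Rabs_pos_eq; repeat split; lra.
      - exists (eps / 2)%R. rewrite Rabs_pos_eq; repeat split; lra. }
    destruct Hw as (y & Hy0 & Hy & Hyz).
    exists (Ci * y). repeat split.
    - apply Cmod_gt_0. rewrite Cmod_mult, Cmod_Ci, Cmod_R, Rmult_1_l.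
      now apply Rabs_pos_lt.
    - rewrite Cmod_mult, Cmod_Ci, Cmod_R. lra.
    - destruct (defect_zero_near (z + Ci * y)) as [r [Hr Hz]].
      + simpl. replace (_ + _)%R with (Im z + y)%R; [exact Hyz|].
        unfold Im. ring.
      + rewrite <- (Cplus_0_r (z + Ci * y)). apply Hz. rewrite Cmod_0. lra. }
  destruct H as [r [Hr Hz]]. rewrite <- (Cplus_0_r z). apply Hz.
  rewrite Cmod_0. lra.
Qed.

Lemma zeta_rhs_value (s : C) :
  terms_defined (S d) s -> rhs_value zeta (S d) s (zeta s).
Proof.
  intros HD. exists (term_sum s). split; [apply term_sum_correct|].
  assert (H := defect_zero s HD). unfold defect, bernoulli_part in H.
  replace (S d - 1)%nat with d by lia.
  set (P := sum_n _ d : C) in *.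
  assert (Hs : s - 1 <> 0).
  { intros E. apply (proj1 HD). replace s with (s - 1 + 1) by ring.
    rewrite E. ring. }
  replace P with ((s - 1) * (zeta s - 1) + term_sum s).
  - field. exact Hs.
  - transitivity ((s - 1) * (zeta s - 1) - P + term_sum s + P); [ring|].
    rewrite H. ring.
Qed.

End Zeta.

Theorem theorem6 (zeta : C -> C) (Hzeta : is_riemann_zeta zeta)
    (Delta : nat) (HDelta : (1 <= Delta)%nat) (s : C) (Hs : s <> 1) :
  extended_rhs_value zeta Delta s (zeta s).
Proof.
  destruct Delta as [|d]; [lia|]. split.
  - now apply zeta_rhs_value.
  - (* The regularized right-hand side is [zeta] itself. *)
    intros _. exists zeta. split.
    + now apply zeta_rhs_value.
    + intros P HP.
      generalize (wiener_at_continuous zeta s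
                    (zeta_wiener_at zeta Hzeta s Hs) P HP).
      unfold filtermap, within.
      apply filter_imp. intros z Hz _. exact Hz.
Qed.
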